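(* Let $A_1,A_2,A_3\in M_3(\mathbb{C})$ be three pairwise commuting contractions, each of the form scalar plus nilpotent of order 2, i.e. $A_i=\lambda_iI+N_i$ with $\lambda_i\in\mathbb{C}$ and $N_i^2=0$. Then there exist commuting isometric coextensions $S_1,S_2,S_3$ of $A_1,A_2,A_3$; that is, there exist a complex Hilbert space $\mathcal{K}\supseteq\mathbb{C}^3$ and pairwise commuting isometries $S_1,S_2,S_3$ on $\mathcal{K}$ such that each $S_i$ is a coextension of $A_i$.
   Context: A contraction is an operator of norm at most $1$ (operator norm on $\mathbb{C}^3$ with its standard inner product). A nilpotent of order 2 means a matrix $N$ with $N^2=0$ (the zero matrix is allowed). A bounded operator $S$ on a Hilbert space $\mathcal{K}\supseteq\mathcal{H}$ is a coextension of an operator $A$ on $\mathcal{H}$ if, with respect to $\mathcal{K}=\mathcal{H}\oplus\mathcal{H}^\perp$, it has the form $S=\begin{bmatrix}A&0\\ *&*\end{bmatrix}$ (equivalently, $S^*$ leaves $\mathcal{H}$ invariant and $S^*|_{\mathcal{H}}=A^*$). *)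

(* Defs.v *)
From mathcomp Require Import all_boot all_order all_algebra.
From mathcomp Require Import complex.
From mathcomp Require Import all_classical all_reals all_analysis.

Set Implicit Arguments.
Unset Strict Implicit.
Unset Printing Implicit Defensive.

Import Order.TTheory GRing.Theory Num.Theory.
Import numFieldNormedType.Exports.

Local Open Scope classical_set_scope.
Local Open Scope complex_scope.
Local Open Scope ring_scope.

(* Complex scalars are R[i] with R an abstract model of the real numbers.
   Inner products are linear in the first argument and conjugate-linear in
   the second one. *)

Record hilbertType (R : realType) := HilbertType {
  hilbert_sort :> completeNormedModType R[i];
  hdot : {dot hilbert_sort for @Num.conj R[i]};
  hdot_norm : forall x : hilbert_sort, `|x| ^+ 2 = hdot x x }.

Section EuclideanSpace.
Variables (R : realType) (n : nat).

Definition cvdot (x y : 'cV[R[i]]_n) : R[i] :=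
  \sum_(k < n) x k 0 * Num.conj (y k 0).

(* The norm that the library puts on matrices is the sup norm, hence this
   Euclidean norm, with values in R. *)
Definition cvnorm (x : 'cV[R[i]]_n) : R := Num.sqrt (complex.Re (cvdot x x)).

(* Taken in the extended reals, so that the supremum is meaningful without
   a boundedness proof. *)
Definition opnorm (A : 'M[R[i]]_n) : \bar R :=
  ereal_sup [set (cvnorm (A *m x))%:E | x in [set x | cvnorm x <= 1]].

Definition contraction_mx (A : 'M[R[i]]_n) : Prop := (opnorm A <= 1)%E.

Definition scalar_plus_nilpotent2 (A : 'M[R[i]]_n) : Prop :=
  exists (lambda : R[i]) (N : 'M[R[i]]_n),
    A = lambda%:M + N /\ N *m N = 0.

End EuclideanSpace.

Section Coextension.
Variables (R : realType) (n : nat) (K : hilbertType R).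

Definition commuting_op (S T : K -> K) : Prop :=
  forall x : K, S (T x) = T (S x).

Definition isometry_op (S : K -> K) : Prop := forall x : K, `|S x| = `|x|.

(* The inclusion of C^n in K is a linear map preserving inner products; C^n
   is identified with its range. *)
Definition isometric_embedding (V : 'cV[R[i]]_n -> K) : Prop :=
  forall x y, hdot K (V x) (V y) = cvdot x y.

Definition orthocompl (H : set K) : set K :=
  [set k | forall h, H h -> hdot K k h = 0].

(* The two columns of the block matrix of S with respect to
   K = range V (+) (range V)^perp are (A, * ) and (0, * ). *)
Definition coextension (V : {linear 'cV[R[i]]_n -> K})
    (A : 'M[R[i]]_n) (S : {linear K -> K}) : Prop :=
  [/\ continuous S,
      forall x, exists2 k, orthocompl (range V) k & S (V x) = V (A *m x) + k
    & forall k, orthocompl (range V) k -> orthocompl (range V) (S k)].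

End Coextension.

(* Main.v *)
From HB Require Import structures.
Require Import Defs.
From mathcomp Require Import all_boot all_order all_algebra.
From mathcomp Require Import complex.
From mathcomp Require Import all_classical all_reals all_analysis.
From mathcomp Require Import ring lra.
Import Order.TTheory GRing.Theory Num.Theory.
Import numFieldNormedType.Exports.
Local Open Scope complex_scope.
Local Open Scope ring_scope.

(** Write A_i = l_i + N_i. Commutation forces N_i N_j = 0, so the N_i, of rank
    at most 1, have a common range or a common kernel: N_i = s_i e w_i^* for
    all i, or N_i = s_i w_i e^* for all i, with unit vectors w_i orthogonal to
    a unit vector e. Contractivity means s_i <= 1 - |l_i|^2, and a Moebius
    transform of the isometries reduces the problem to l_i = 0, 0 <= s_i <= 1.

    The plane orthogonal to e has a tight frame (g_k) against which w_1, w_2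
    and w_3 have unimodular coefficients; this amounts to writing a 3x3 complex
    correlation matrix as a convex combination of rank one ones. The diagonal
    unitaries built from these coefficients, tensored with the unilateral shift
    on l^2, give the commuting isometries. A number s in [0, 1] is absorbed as
    the mean of two conjugate unimodular numbers, which doubles the frame. *)

Set Implicit Arguments.
Unset Strict Implicit.
Unset Printing Implicit Defensive.
Local Open Scope classical_set_scope.

(** * The Euclidean space C^n *)

Lemma comm_mx_sub_scalar (F : comNzRingType) n (A B : 'M[F]_n) a b :
  A *m B = B *m A ->
  (A - a%:M) *m (B - b%:M) = (B - b%:M) *m (A - a%:M).
Proof.
move=> AB; rewrite !mulmxBl !mulmxBr AB (scalar_mxC a B) (scalar_mxC b A).
by rewrite (scalar_mxC a b%:M) !opprB !addrA [LHS](ACl (1*4*3*2)).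
Qed.

Section Euclid.
Variable R : realType.
Local Notation C := R[i].
Local Notation conj := (@Num.conj C).
Variable n : nat.
Implicit Types (x y z : 'cV[C]_n) (A B M N : 'M[C]_n).

Lemma cvdotDZl (a : C) (x y z : 'cV[C]_n) :
  cvdot (a *: x + y) z = a * cvdot x z + cvdot y z.
Proof.
rewrite /cvdot mulr_sumr -big_split /=; apply: eq_bigr => i _.
by rewrite !mxE mulrDl mulrA.
Qed.

Lemma cvdot0l (z : 'cV[C]_n) : cvdot 0 z = 0.
Proof. by rewrite /cvdot big1 // => i _; rewrite mxE mul0r. Qed.

Lemma cvdotZl (a : C) (x z : 'cV[C]_n) : cvdot (a *: x) z = a * cvdot x z.
Proof. by rewrite -[a *: x]addr0 cvdotDZl cvdot0l addr0. Qed.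

Lemma cvdotC (x y : 'cV[C]_n) : cvdot x y = Num.conj (cvdot y x).
Proof.
rewrite /cvdot rmorph_sum; apply: eq_bigr => i _ /=.
by rewrite rmorphM /= conjCK mulrC.
Qed.

Lemma cvdotDl x y z : cvdot (x + y) z = cvdot x z + cvdot y z.
Proof. by rewrite -[x in LHS]scale1r cvdotDZl mul1r. Qed.

Lemma cvdotDr x y z : cvdot x (y + z) = cvdot x y + cvdot x z.
Proof. by rewrite cvdotC cvdotDl rmorphD /= -!cvdotC. Qed.

Lemma cvdotZr (a : C) x y : cvdot x (a *: y) = conj a * cvdot x y.
Proof. by rewrite cvdotC cvdotZl rmorphM /= -cvdotC. Qed.

Lemma cvdot_suml (I : finType) (F : I -> 'cV[C]_n) y :
  cvdot (\sum_i F i) y = \sum_i cvdot (F i) y.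
Proof.
apply: (big_morph (fun x => cvdot x y)) => [a b|].
  exact: cvdotDl.
exact: cvdot0l.
Qed.

Lemma cvdot_sumr (I : finType) (F : I -> 'cV[C]_n) y :
  cvdot y (\sum_i F i) = \sum_i cvdot y (F i).
Proof.
apply: (big_morph (cvdot y)) => [a b|]; first exact: cvdotDr.
by rewrite cvdotC cvdot0l conjC0.
Qed.

Lemma cvdotE x : cvdot x x = \sum_(k < n) `|x k 0| ^+ 2.
Proof. by apply: eq_bigr => k _; rewrite normCK. Qed.

Lemma cvdot_ge0 x : 0 <= cvdot x x.
Proof. by rewrite cvdotE sumr_ge0 // => k _; rewrite exprn_ge0. Qed.

Lemma cvdot_eq0 x : cvdot x x = 0 -> x = 0.
Proof.
rewrite cvdotE => /eqP; rewrite psumr_eq0 => [/allP x0|k _]; last first.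
  exact: exprn_ge0.
apply/colP => k; rewrite mxE; have := x0 k (mem_index_enum k).
by rewrite /= expf_eq0 normr_eq0 /= => /eqP.
Qed.

Lemma cvdot_inj x y :
  (forall h, cvdot x h = cvdot y h) -> x = y.
Proof.
move=> xy; apply/colP => k.
have E (z : 'cV[C]_n) : cvdot z (delta_mx k 0) = z k 0.
  rewrite /cvdot (bigD1 k) //= mxE !eqxx conjC1 mulr1 big1 ?addr0 // => j jk.
  by rewrite mxE (negPf jk) conjC0 mulr0.
by rewrite -!E.
Qed.

Lemma cvdot_normalize x : x != 0 ->
  let s := sqrtC (cvdot x x) in
  [/\ 0 < s, s ^+ 2 = cvdot x x & cvdot (s^-1 *: x) (s^-1 *: x) = 1].
Proof.
move=> x0 s; have x_gt0 : 0 < cvdot x x.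
  by rewrite lt_def cvdot_ge0 andbT; apply: contra_neq x0; exact: cvdot_eq0.
have s_gt0 : 0 < s by rewrite sqrtC_gt0.
have sE : s ^+ 2 = cvdot x x by rewrite sqrtCK.
split=> //; rewrite cvdotZl cvdotZr fmorphV /= (conj_Creal (gtr0_real s_gt0)).
by rewrite -sE expr2 mulKf ?mulVf // gt_eqF.
Qed.

Definition ctmx p q (M : 'M[C]_(p, q)) : 'M[C]_(q, p) := (map_mx conj M)^T.

Lemma ctmxK p q (M : 'M[C]_(p, q)) : ctmx (ctmx M) = M.
Proof. by apply/matrixP => i j; rewrite !mxE conjCK. Qed.

Lemma ctmxM p q r (M : 'M[C]_(p, q)) (N : 'M[C]_(q, r)) :
  ctmx (M *m N) = ctmx N *m ctmx M.
Proof. by rewrite /ctmx map_mxM trmx_mul. Qed.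

Lemma ctmxZ p q a (M : 'M[C]_(p, q)) : ctmx (a *: M) = conj a *: ctmx M.
Proof. by apply/matrixP => i j; rewrite !mxE rmorphM. Qed.

Lemma ctmx_mul x y : ctmx y *m x = (cvdot x y)%:M.
Proof.
apply/matrixP => i j; rewrite !ord1 !mxE eqxx mulr1n.
by apply: eq_bigr => k _; rewrite !mxE mulrC.
Qed.

Definition outer x y : 'M[C]_n := x *m ctmx y.

Lemma outerE x y z : outer x y *m z = cvdot z y *: x.
Proof. by rewrite /outer -mulmxA ctmx_mul mul_mx_scalar. Qed.

Lemma ctmx_outer x y : ctmx (outer x y) = outer y x.
Proof. by rewrite ctmxM ctmxK. Qed.

Lemma outer_sqr0 x y : cvdot x y = 0 -> outer x y *m outer x y = 0.
Proof. by move=> xy; rewrite {2}/outer mulmxA outerE xy scale0r mul0mx. Qed.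

(** Orthonormality says that the matrix [M] with columns [u j] satisfies [ctmx M *m M = 1]. Since
    [M] is square, also [M *m ctmx M = 1], which is the expansion. *)
Lemma orthonormal_expansion (u : 'I_n -> 'cV[C]_n) :
  (forall i j, cvdot (u i) (u j) = (i == j)%:R) ->
  forall x, \sum_j cvdot x (u j) *: u j = x.
Proof.
move=> uu x; pose M : 'M[C]_n := \matrix_(i, j) u j i 0.
have MM : ctmx M *m M = 1%:M.
  apply/matrixP => i j; rewrite !mxE eq_sym -uu.
  by apply: eq_bigr => k _; rewrite !mxE mulrC.
rewrite -[RHS]mul1mx -(mulmx1C MM) -mulmxA; apply/colP => k.
rewrite summxE mxE; apply: eq_bigr => j _; rewrite !mxE mulrC; congr (_ * _).
by apply: eq_bigr => l _; rewrite !mxE mulrC.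
Qed.

Lemma rank1_outer M : (\rank M <= 1)%N ->
  exists (u : 'cV[C]_n) (v : 'rV[C]_n), M = u *m v.
Proof.
have [->|M0] := eqVneq M 0; first by exists 0, 0; rewrite mul0mx.
have /rowV0Pn[v vM v0] := M0; move=> rM.
have Mv : (M <= v)%MS.
  by rewrite -(geq_leqif (mxrank_leqif_sup vM)) rank_rV v0.
by have /submxP[u ->] := Mv; exists u, v.
Qed.

Lemma exists_unit_perp (a b : 'cV[C]_n) : (2 < n)%N ->
  exists x, [/\ cvdot x x = 1, cvdot x a = 0 & cvdot x b = 0].
Proof.
(* Two columns have a nonzero left kernel in dimension n > 2. They are conjugated so that a kernel
   row, once transposed, is orthogonal to [a] and [b] for [cvdot]. *)
move=> n2; pose M := row_mx (map_mx conj a) (map_mx conj b).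
have : kermx M != 0.
  rewrite kermx_eq0 -row_leq_rank -ltnNge.
  exact: leq_ltn_trans (rank_leq_col _) _.
case/rowV0Pn => v /sub_kermxP; rewrite mul_mx_row => vM v0.
have [va vb] : v *m map_mx conj a = 0 /\ v *m map_mx conj b = 0.
  by apply: eq_row_mx; rewrite vM row_mx0.
have dotE (c : 'cV[C]_n) : v *m map_mx conj c = 0 -> cvdot v^T c = 0.
  move=> /matrixP/(_ 0 0); rewrite !mxE => <-.
  by apply: eq_bigr => k _; rewrite !mxE.
have vT0 : v^T != 0 by rewrite trmx_eq0.
have [_ _ x1] := cvdot_normalize vT0.
eexists; split; first exact: x1.
  by rewrite cvdotZl (dotE a va) mulr0.
by rewrite cvdotZl (dotE b vb) mulr0.
Qed.

Lemma contraction_mxP A : contraction_mx A -> forall x,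
  cvdot (A *m x) (A *m x) <= cvdot x x.
Proof.
move=> Ac x.
have norm_le y : (cvnorm y <= 1) = (cvdot y y <= 1).
  rewrite /cvnorm -[X in _ <= X]sqrtr1 ler_psqrt ?nnegrE ?ler01 //; last first.
    by rewrite -ler0c RRe_real ?ger0_real ?cvdot_ge0.
  by rewrite -lecR RRe_real // ger0_real ?cvdot_ge0.
have [->|x0] := eqVneq x 0; first by rewrite mulmx0.
have [s_gt0 sE s1] := cvdot_normalize x0; set s := sqrtC _ in s_gt0 sE s1.
have : cvdot (A *m (s^-1 *: x)) (A *m (s^-1 *: x)) <= 1.
  rewrite -norm_le -lee_fin; apply: le_trans Ac.
  by apply: ereal_sup_ubound; exists (s^-1 *: x) => //=; rewrite norm_le s1.
rewrite -scalemxAr cvdotZl cvdotZr fmorphV /= (conj_Creal (gtr0_real s_gt0)).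
by rewrite mulrA -invfM -expr2 mulrC ler_pdivrMr ?exprn_gt0 // mul1r sE.
Qed.

Lemma cvdot_comb (a b : 'cV[C]_n) (al be : C) :
  cvdot a a = 1 -> cvdot b b = 1 -> cvdot a b = 0 ->
  cvdot (al *: a + be *: b) (al *: a + be *: b) = `|al| ^+ 2 + `|be| ^+ 2.
Proof.
move=> aa bb ab; have ba : cvdot b a = 0 by rewrite cvdotC ab conjC0.
rewrite cvdotDl !cvdotDr !cvdotZl !cvdotZr aa bb ab ba !mulr0 !mulr1.
by rewrite add0r addr0 !normCK.
Qed.

(* The bound on [s] is tested on [s conj(lambda) a + (1 - |lambda|^2) b]. *)
Lemma contraction_outer (a b : 'cV[C]_n) (lambda s : C) :
  cvdot a a = 1 -> cvdot b b = 1 -> cvdot a b = 0 -> 0 <= s ->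
  contraction_mx (lambda%:M + s *: outer a b) ->
  `|lambda| <= 1 /\ s <= 1 - `|lambda| ^+ 2.
Proof.
move=> aa bb ab s0 /contraction_mxP Ac.
have AE al be : (lambda%:M + s *: outer a b) *m (al *: a + be *: b) =
    (lambda * al + s * be) *: a + (lambda * be) *: b.
  rewrite mulmxDl mul_scalar_mx -scalemxAl outerE cvdotDl !cvdotZl ab bb mulr0.
  by rewrite add0r mulr1 scalerDr !scalerA addrAC -scalerDl.
have qle al be : `|lambda * al + s * be| ^+ 2 + `|lambda * be| ^+ 2 <=
    `|al| ^+ 2 + `|be| ^+ 2.
  by have := Ac (al *: a + be *: b); rewrite AE !cvdot_comb.
set D := 1 - `|lambda| ^+ 2.
(* Testing on [b] alone gives s^2 + |lambda|^2 <= 1, hence [0 <= D], and s = 0 in the degenerate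
   case D = 0. *)
have := qle 0 1; rewrite mulr0 add0r !mulr1 normr0 expr0n /= add0r.
rewrite normr1 expr1n (ger0_norm s0) => q1.
have D0 : 0 <= D.
  by rewrite subr_ge0; apply: le_trans q1; rewrite lerDr exprn_ge0.
have l1 : `|lambda| <= 1 by rewrite -ler_sqr ?nnegrE // expr1n -subr_ge0.
split=> //; have [D00|Dn0] := eqVneq D 0.
  move: q1; rewrite -lerBrDr -/D D00 => s2.
  have /eqP : s ^+ 2 = 0 by apply: le_anti; rewrite s2 exprn_ge0.
  by rewrite expf_eq0 /= => /eqP ->.
have D_gt0 : 0 < D by rewrite lt_def Dn0.
have lJ : lambda * conj lambda = 1 - D by rewrite /D opprB addrC subrK normCK.
have := qle (s * conj lambda) D.
have -> : lambda * (s * conj lambda) + s * D = s.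
  by rewrite mulrCA lJ -mulrDr subrK mulr1.
rewrite !normrM norm_conjC !exprMn (ger0_norm s0) (ger0_norm D0).
rewrite -subr_ge0 -[s <= D]ler_sqr ?nnegrE // -[s ^+ 2 <= D ^+ 2]subr_ge0.
(* The gap in the inequality factors through [D], which is positive here and can be cancelled. *)
have -> : s ^+ 2 * `|lambda| ^+ 2 + D ^+ 2 -
  (s ^+ 2 + `|lambda| ^+ 2 * D ^+ 2) = D * (D ^+ 2 - s ^+ 2).
  by rewrite /D; ring.
by rewrite pmulr_rge0.
Qed.

End Euclid.

(** * The Hilbert space of square summable sequences *)

Section SquareNorm.
Variable R : realType.
Implicit Types (z w : R[i]).

(** The squared modulus takes its values in [R], so that the theory of real series applies to
    complex sequences. *)
Definition sqm z : R := complex.Re z ^+ 2 + complex.Im z ^+ 2.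

Lemma sqm_ge0 z : 0 <= sqm z.
Proof. by rewrite addr_ge0 // sqr_ge0. Qed.

Lemma sqmE z : (sqm z)%:C = z * z^*%C.
Proof. by rewrite /sqm add_Re2_Im2 sqr_normc. Qed.

Lemma sqm_eq0 z : sqm z = 0 -> z = 0.
Proof.
move/eqP; rewrite paddr_eq0 ?sqr_ge0 // !sqrf_eq0 => /andP[/eqP a /eqP b].
by case: z a b => x y /= -> ->.
Qed.

Lemma sqmM z w : sqm (z * w) = sqm z * sqm w.
Proof. case: z => a b; case: w => c d; rewrite /sqm /=; ring. Qed.

Lemma sqmD_le z w : sqm (z + w) <= 2 * (sqm z + sqm w).
Proof.
case: z => a b; case: w => c d; rewrite /sqm /=.
have := sqr_ge0 (a - c); have := sqr_ge0 (b - d); nra.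
Qed.

(** With its analogue for [Im], this gives a summable majorant for the terms of the inner product of
    two square summable sequences. *)
Lemma Re_conjM_le z w : `|complex.Re (z * w^*%C)| <= sqm z + sqm w.
Proof.
case: z => a b; case: w => c d; rewrite /sqm /= ler_norml.
have := sqr_ge0 (a - c); have := sqr_ge0 (b - d).
have := sqr_ge0 (a + c); have := sqr_ge0 (b + d).
by move=> *; apply/andP; split; nra.
Qed.

Lemma Im_conjM_le z w : `|complex.Im (z * w^*%C)| <= sqm z + sqm w.
Proof.
case: z => a b; case: w => c d; rewrite /sqm /= ler_norml.
have := sqr_ge0 (a - d); have := sqr_ge0 (b - c).
have := sqr_ge0 (a + d); have := sqr_ge0 (b + c).
by move=> *; apply/andP; split; nra.
Qed.

Lemma ReD z w : complex.Re (z + w) = complex.Re z + complex.Re w.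
Proof. by case: z => a b; case: w. Qed.
Lemma ImD z w : complex.Im (z + w) = complex.Im z + complex.Im w.
Proof. by case: z => a b; case: w. Qed.
Lemma ReM (z w : R[i]) : complex.Re (z * w) =
  complex.Re z * complex.Re w - complex.Im z * complex.Im w.
Proof. by case: z => a b; case: w. Qed.
Lemma ImM (z w : R[i]) : complex.Im (z * w) =
  complex.Re z * complex.Im w + complex.Im z * complex.Re w.
Proof. by case: z => a b; case: w. Qed.

Lemma sqm_normE z : (sqm z)%:C = `|z| ^+ 2.
Proof. by rewrite sqmE -sqr_normc. Qed.

Lemma sqm_unimodular w z : `|w| = 1 -> sqm (w * z) = sqm z.
Proof.
by move=> w1; apply: complexI; rewrite !sqm_normE normrM w1 mul1r.
Qed.

End SquareNorm.

Section L2.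
Variable R : realType.
Local Notation C := R[i].

Definition l2_pred : {pred nat -> C} :=
  [pred f | `[< cvgn (series (fun n => sqm (f n))) >]].

Lemma l2_predP f :
  reflect (cvgn (series (fun n => sqm (f n)))) (f \in l2_pred).
Proof. exact: asboolP. Qed.

Lemma l2_submod_closed : submod_closed l2_pred.
Proof.
split=> [|a f g /l2_predP cf /l2_predP cg]; apply/l2_predP.
  rewrite (_ : (fun _ => _) = 0); last first.
    by apply/funext => n; rewrite /sqm /= expr0n addr0.
  have -> : series (0 : nat -> R) = fun=> 0.
    by apply/funext => n; rewrite /series /= big1.
  exact: is_cvg_cst.
have cM : cvgn (series (2 *: (sqm a *: (fun n => sqm (f n)) +
    (fun n => sqm (g n))))).
  by apply: is_cvg_seriesZ; apply: is_cvg_seriesD => //; apply: is_cvg_seriesZ.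
apply: series_le_cvg cM => n; first exact: sqm_ge0.
  change (0 <= 2 * (sqm a * sqm (f n) + sqm (g n))).
  by rewrite mulr_ge0 // addr_ge0 ?mulr_ge0 ?sqm_ge0.
by apply: le_trans (sqmD_le _ _) _; rewrite sqmM.
Qed.

HB.instance Definition _ := GRing.isSubmodClosed.Build _ _ l2_pred
  l2_submod_closed.

Record l2 := L2 { l2_val :> nat -> C; l2_valP : l2_val \in l2_pred }.
HB.instance Definition _ := [isSub of l2 for l2_val].
HB.instance Definition _ := [Choice of l2 by <:].
HB.instance Definition _ := [SubChoice_isSubLmodule of l2 by <:].
End L2.

Section DotNorm.
Variables (C : numClosedFieldType) (U : lmodType C).
Variable form : {dot U for @Num.conj C}.

(** With a = |u| and b = |v|, positivity of the form at [b *: u - a *: v] bounds the real part of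
    [form u v] by ab. This half of Cauchy-Schwarz is what the expansion of |u + v|^2 requires. *)
Lemma dnorm_triangle u v :
  sqrtC (form (u + v) (u + v)) <= sqrtC (form u u) + sqrtC (form v v).
Proof.
set a := sqrtC (form u u); set b := sqrtC (form v v).
have a_ge0 : 0 <= a by exact: sqrt_dnorm_ge0.
have b_ge0 : 0 <= b by exact: sqrt_dnorm_ge0.
rewrite -ler_sqr ?nnegrE ?sqrtC_ge0 ?dnorm_ge0 ?addr_ge0 // sqrtCK.
have [u0|u0] := eqVneq u 0.
  have -> : a = 0 by rewrite /a u0 linear0r sqrtC0.
  by rewrite u0 !add0r sqrtCK.
have [v0|v0] := eqVneq v 0.
  have -> : b = 0 by rewrite /b v0 linear0r sqrtC0.
  by rewrite v0 !addr0 sqrtCK.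
have a_gt0 : 0 < a by rewrite sqrt_dnorm_gt0.
have b_gt0 : 0 < b by rewrite sqrt_dnorm_gt0.
rewrite dnormD sqrrD !sqrtCK addrAC lerD2r lerD2l.
set d := form u v; set d' := Num.conj d.
have Ed : form (b *: u) (a *: v) = b * (a * d).
  rewrite linearZr_LR /= (conj_Creal (ger0_real a_ge0)) linearZl_LR /=.
  by rewrite mulrCA.
have := dnorm_ge0 form (b *: u - a *: v).
rewrite dnormB Ed !dnormZ !ger0_norm //.
rewrite -[form u u]sqrtCK -[form v v]sqrtCK -/a -/b.
rewrite !rmorphM /= (conj_Creal (ger0_real a_ge0)).
rewrite (conj_Creal (ger0_real b_ge0)) -/d'.
have -> : b ^+ 2 * a ^+ 2 + a ^+ 2 * b ^+ 2 -
    (b * (a * d) + b * (a * d')) = (a * b) * ((a * b *+ 2) - (d + d')).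
  by ring.
by rewrite pmulr_rge0 ?mulr_gt0 // subr_ge0.
Qed.
End DotNorm.

Lemma series_finite_cvg (R : realType) (v : nat -> R) N :
  (forall n, (N <= n)%N -> v n = 0) ->
  series v @ \oo --> \sum_(0 <= n < N) v n.
Proof.
move=> v0; apply: cvg_near_cst; near=> n.
have Nn : (N <= n)%N by near: n; exact: nbhs_infty_ge.
rewrite /series /= (@big_cat_nat _ _ _ N) //=.
rewrite [X in _ + X](_ : _ = 0) ?addr0 // big_nat big1 // => i /andP[Ni _].
exact: v0.
Unshelve. all: by end_near. Qed.

Section ComplexSeries.
Variable R : realType.
Local Notation C := R[i].
Implicit Types (u v : nat -> C).

Definition csummable u :=
  cvgn (series (fun n => complex.Re (u n))) /\
  cvgn (series (fun n => complex.Im (u n))).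

Definition csum u : C :=
  limn (series (fun n => complex.Re (u n))) +i*
  limn (series (fun n => complex.Im (u n))).

Lemma csummableD u v : csummable u -> csummable v ->
  csummable (fun n => u n + v n) /\
  csum (fun n => u n + v n) = csum u + csum v.
Proof.
move=> [ru iu] [rv iv].
have Er : (fun n => complex.Re (u n + v n)) =
  (fun n => complex.Re (u n)) + (fun n => complex.Re (v n)).
  by apply/funext => n; rewrite ReD.
have Ei : (fun n => complex.Im (u n + v n)) =
  (fun n => complex.Im (u n)) + (fun n => complex.Im (v n)).
  by apply/funext => n; rewrite ImD.
split; first by split; rewrite ?Er ?Ei; apply: is_cvg_seriesD.
by rewrite /csum Er Ei !lim_seriesD.
Qed.

Lemma csummableZ (a : C) u : csummable u ->
  csummable (fun n => a * u n) /\ csum (fun n => a * u n) = a * csum u.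
Proof.
move=> [ru iu].
have Er : (fun n => complex.Re (a * u n)) =
  complex.Re a *: (fun n => complex.Re (u n)) -
  complex.Im a *: (fun n => complex.Im (u n)).
  by apply/funext => n; rewrite ReM.
have Ei : (fun n => complex.Im (a * u n)) =
  complex.Re a *: (fun n => complex.Im (u n)) +
  complex.Im a *: (fun n => complex.Re (u n)).
  by apply/funext => n; rewrite ImM.
split.
  split; rewrite ?Er ?Ei.
    by apply: is_cvg_seriesB; apply: is_cvg_seriesZ.
  by apply: is_cvg_seriesD; apply: is_cvg_seriesZ.
have cz (v : nat -> R) k : cvgn (series v) -> cvgn (series (k *: v)).
  exact: is_cvg_seriesZ.
rewrite /csum Er Ei (lim_seriesB (cz _ _ ru) (cz _ _ iu)).
rewrite (lim_seriesD (cz _ _ iu) (cz _ _ ru)) !lim_seriesZ //.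
by apply/eqP; rewrite eq_complex !ReM !ImM !eqxx.
Qed.

Lemma csummableJ u : csummable u ->
  csum (fun n => (u n)^*%C) = (csum u)^*%C.
Proof.
move=> [ru iu]; rewrite /csum /=; congr (_ +i* _).
  by congr (limn (series _)); apply/funext => n; case: (u n).
have -> : (fun n => complex.Im (u n)^*%C) = -1 *: (fun n => complex.Im (u n)).
  by apply/funext => n; rewrite scaleN1r /GRing.opp /=; case: (u n).
by rewrite lim_seriesZ // scaleN1r.
Qed.

Lemma csummable_le u (v : nat -> R) : cvgn (series v) ->
  (forall n, `|complex.Re (u n)| <= v n /\ `|complex.Im (u n)| <= v n) ->
  csummable u.
Proof.
move=> cv uv; have v0 n : 0 <= v n by apply: le_trans (proj1 (uv n)).
by split; apply: normed_cvg; apply: series_le_cvg cv => // n;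
  rewrite ?normr_ge0 //; have [] := uv n.
Qed.

Lemma csum_finite u N : (forall n, (N <= n)%N -> u n = 0) ->
  csum u = \sum_(n < N) u n.
Proof.
move=> u0.
have limE (p : C -> R) : p 0 = 0 ->
    limn (series (fun n => p (u n))) = \sum_(0 <= n < N) p (u n).
  move=> p0; apply: cvg_lim => //; apply: series_finite_cvg => n /u0 ->.
  exact: p0.
rewrite /csum !limE //.
apply/eqP; rewrite eq_complex /= !big_mkord.
by rewrite (big_morph _ (@ReD R) erefl) (big_morph _ (@ImD R) erefl) !eqxx.
Qed.

Lemma csum_real (v : nat -> R) :
  csum (fun n => (v n)%:C) = (limn (series v))%:C.
Proof.
rewrite /csum /=; congr (_ +i* _).
rewrite (_ : series _ = fun=> 0); first exact: lim_cst.
by apply/funext => n; rewrite /series /= big1.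
Qed.
End ComplexSeries.

Section L2dot.
Variable R : realType.
Local Notation C := R[i].
Implicit Types f g h : l2 R.

Definition l2dot f g : C := csum (fun n => f n * (g n)^*%C).

Lemma l2_dot_summable f g : csummable (fun n => f n * (g n)^*%C).
Proof.
have /l2_predP cf := l2_valP f; have /l2_predP cg := l2_valP g.
apply: csummable_le (is_cvg_seriesD cf cg) _ => n.
by split; [exact: Re_conjM_le | exact: Im_conjM_le].
Qed.

Lemma l2dotC f g : l2dot f g = (l2dot g f)^*%C.
Proof.
rewrite -csummableJ; last exact: l2_dot_summable.
by congr csum; apply/funext => n; rewrite rmorphM /= conjcK mulrC.
Qed.

Lemma l2dot_linear h : linear_for *%R (l2dot^~ h).
Proof.
move=> a f g; rewrite /l2dot.
have [sf sg] := (l2_dot_summable f h, l2_dot_summable g h).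
have [sZ <-] := csummableZ a sf; have [_ <-] := csummableD sZ sg.
by congr csum; apply/funext => n; rewrite /= mulrDl -mulrA.
Qed.

Lemma l2dot_linearr h : linear_for (Num.conj \; *%R) (l2dot h).
Proof.
move=> a f g; rewrite [LHS]l2dotC l2dot_linear rmorphD rmorphM.
by rewrite [l2dot h f]l2dotC [l2dot h g]l2dotC.
Qed.

HB.instance Definition _ := bilinear_isBilinear.Build C (l2 R) (l2 R) C
  *%R (Num.conj \; *%R) l2dot (l2dot_linear, l2dot_linearr).

HB.instance Definition _ := isHermitianSesquilinear.Build C (l2 R) false
  Num.conj l2dot (fun f g => etrans (l2dotC f g) (esym (mul1r _))).

Lemma l2dotE f : l2dot f f = (limn (series (fun n => sqm (f n))))%:C.
Proof.
by rewrite -csum_real; congr csum; apply/funext => n; rewrite sqmE.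
Qed.

Lemma l2_partial_le f N :
  series (fun n => sqm (f n)) N <= limn (series (fun n => sqm (f n))).
Proof.
apply: nondecreasing_cvgn_le; last exact/l2_predP/l2_valP.
by apply/nondecreasing_series => n _ _; exact: sqm_ge0.
Qed.

Lemma l2dot_gt0 f : f != 0 -> 0 < l2dot f f.
Proof.
move=> f0; rewrite l2dotE -[0]/(0%:C) ltcR.
have [n fn0] : exists n, f n != 0.
  apply: contrapT => /forallNP fn0; case/eqP: f0; apply/val_inj/funext => n.
  by apply/eqP; apply: contrapT => /negP; exact: fn0.
apply: lt_le_trans (l2_partial_le f n.+1).
rewrite /series /= big_nat_recr //= ltr_wpDl ?sumr_ge0 // => [i _|].
  exact: sqm_ge0.
by rewrite lt_def sqm_ge0 andbT; apply: contra_neq fn0; exact: sqm_eq0.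
Qed.

HB.instance Definition _ := isDotProduct.Build C (l2 R) l2dot l2dot_gt0.

Definition l2norm f : C := sqrtC (l2dot f f).

Lemma l2normD f g : l2norm (f + g) <= l2norm f + l2norm g.
Proof. exact: (dnorm_triangle l2dot). Qed.

Lemma l2normZ a f : l2norm (a *: f) = `|a| * l2norm f.
Proof.
rewrite /l2norm (dnormZ l2dot) sqrtCM ?nnegrE ?exprn_ge0 ?(dnorm_ge0 l2dot) //.
by rewrite sqrCK.
Qed.

Lemma l2norm_eq0 f : l2norm f = 0 -> f = 0.
Proof. by move/eqP; rewrite (sqrt_dnorm_eq0 l2dot) => /eqP. Qed.

HB.instance Definition _ := Lmodule_isNormed.Build C (l2 R)
  l2normD l2normZ l2norm_eq0.

Lemma l2norm_sqr f : `|f| ^+ 2 = l2dot f f.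
Proof. exact: sqrtCK. Qed.

End L2dot.

(** * Completeness of the sequence space *)

Section L2complete.
Variable R : realType.
Local Notation C := R[i].
Implicit Types f g h : l2 R.

(** Bounds on finite partial sums survive coordinatewise limits, which is how norm bounds are
    carried to the limit of a Cauchy filter. *)
Lemma l2_norm_leP f (r : R) : 0 <= r ->
  (`|f| <= r%:C) <-> (forall N, series (fun n => sqm (f n)) N <= r ^+ 2).
Proof.
move=> r0; have r0C : 0 <= r%:C by rewrite -[0]/(0%:C) lecR.
rewrite -ler_sqr ?nnegrE // l2norm_sqr l2dotE -rmorphXn lecR; split.
  by move=> fr N; apply: le_trans (l2_partial_le f N) fr.
move=> fr; apply: limr_le; last by apply: nearW.
exact/l2_predP/l2_valP.
Qed.

Lemma l2_coord_le f (r : R) n : 0 <= r -> `|f| <= r%:C ->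
  `|complex.Re (f n)| <= r /\ `|complex.Im (f n)| <= r.
Proof.
move=> r0 /(l2_norm_leP _ r0)/(_ n.+1).
rewrite /series /= big_nat_recr //= => fr.
have {}fr : sqm (f n) <= r ^+ 2.
  by apply: le_trans fr; rewrite lerDr sumr_ge0 // => i _; exact: sqm_ge0.
split; rewrite -(ler_pXn2r (n:=2)) ?nnegrE // real_normK ?num_real //.
  by apply: le_trans fr; rewrite /sqm lerDl sqr_ge0.
by apply: le_trans fr; rewrite /sqm lerDr sqr_ge0.
Qed.

Lemma l2_cauchyP (F : set_system (l2 R)) : ProperFilter F -> cauchy F ->
  forall e : R, 0 < e ->
  exists2 A, F A & forall f g, A f -> A g -> `|f - g| <= e%:C.
Proof.
move=> FF /cauchy_ballP Fc e e0.
have e0C : 0 < e%:C by rewrite -[0]/(0%:C) ltcR.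
have [[A B] /= [FA FB] AB] := Fc _ e0C.
exists (A `&` B); first exact: filterI.
move=> f g [Af _] [_ Bg]; have := AB (f, g) (conj Af Bg).
by rewrite /= -ball_normE /= => /ltW.
Qed.

(** Here [p] stands for the real or the imaginary part. Being additive and dominated by the norm,
    the coordinate map sends a Cauchy filter to a Cauchy filter of reals. *)
Lemma l2_coord_cvg (F : set_system (l2 R)) (p : C -> R) :
  ProperFilter F -> cauchy F -> (forall z w, p (z - w) = p z - p w) ->
  (forall f r n, 0 <= r -> `|f| <= r%:C -> `|p (f n)| <= r) ->
  forall n, cvg ((fun f : l2 R => p (f n)) @ F).
Proof.
move=> FF Fc pB ple n; apply: R_complete.
apply/cauchy_ballP => e e0.
(* Halving [e] turns the large inequality of [l2_cauchyP] into the strict one that defines a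
   ball. *)
have e20 : 0 < e / 2 by rewrite divr_gt0.
have [A FA AA] := l2_cauchyP FF Fc e20.
pose B := [set x | exists2 f : l2 R, A f & x = p (f n)].
exists (B, B).
  by split; apply: (@filterS _ F _ A) => // f Af; exists f.
move=> [x y] /= [[f Af ->] [g Ag ->]].
rewrite /ball /= -pB.
have := ple _ _ n (ltW e20) (AA _ _ Af Ag) => /le_lt_trans; apply.
by rewrite ltr_pdivrMr // ltr_pMr // ltr1n.
Qed.

(** Let [g] be the coordinatewise limit. The Cauchy bound on the partial sums of f - h passes to f -
    g as h follows the filter; this makes f - g, hence [g], square summable, and gives convergence
    in norm. *)
Lemma l2_complete (F : set_system (l2 R)) : ProperFilter F -> cauchy F -> cvg F.
Proof.
move=> FF Fc.
have cR n : cvg ((fun f : l2 R => complex.Re (f n)) @ F).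
  apply: l2_coord_cvg => //; first by move=> [a b] [c d].
  by move=> f r m r0 /(l2_coord_le m r0)[].
have cI n : cvg ((fun f : l2 R => complex.Im (f n)) @ F).
  apply: l2_coord_cvg => //; first by move=> [a b] [c d].
  by move=> f r m r0 /(l2_coord_le m r0)[].
pose gR n := lim ((fun f : l2 R => complex.Re (f n)) @ F).
pose gI n := lim ((fun f : l2 R => complex.Im (f n)) @ F).
pose g n : C := gR n +i* gI n.
have sqm_cvg (f : l2 R) n :
    (fun h : l2 R => sqm (f n - h n)) @ F --> sqm (f n - g n).
  have part_cvg (p : C -> R) (l : R) : (forall z w, p (z - w) = p z - p w) ->
      (fun h : l2 R => p (h n)) @ F --> l ->
      (fun h : l2 R => p (f n - h n) ^+ 2) @ F --> (p (f n) - l) ^+ 2.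
    move=> pB pl; under eq_fun do rewrite pB expr2.
    by rewrite expr2; apply: cvgM; apply: cvgB => //; exact: cvg_cst.
  have -> : sqm (f n - g n) =
      (complex.Re (f n) - gR n) ^+ 2 + (complex.Im (f n) - gI n) ^+ 2.
    by rewrite /sqm; case: (f n).
  apply: cvgD; apply: part_cvg; [|exact: cR | |exact: cI];
    by move=> [a b] [c d].
have ser_cvg (f : l2 R) N :
    (fun h : l2 R => series (fun n => sqm (f n - h n)) N) @ F -->
    series (fun n => sqm (f n - g n)) N.
  rewrite /series /=; elim: N => [|N IH].
    by rewrite big_geq //; under eq_fun do rewrite big_geq //; exact: cvg_cst.
  rewrite big_nat_recr //=; under eq_fun do rewrite big_nat_recr //=.
  exact: cvgD.
have key (e : R) : 0 < e -> exists2 A, F A & forall (f : l2 R) N, A f ->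
    series (fun n => sqm (f n - g n)) N <= e ^+ 2.
  move=> e0; have [A FA AA] := l2_cauchyP FF Fc e0.
  exists A => // f N Af; apply: cvgr_to_le (ser_cvg f N) _.
  apply: filterS FA => h Ah.
  by have /(l2_norm_leP _ (ltW e0))/(_ N) := AA f h Af Ah.
have g2 : g \in @l2_pred R.
  have [A FA AA] := key 1 ltr01.
  have [f Af] := filter_ex FA.
  have -> : g = l2_val f - (l2_val f - g) by rewrite opprB addrC subrK.
  rewrite rpredB ?l2_valP //; apply/l2_predP; apply: nondecreasing_is_cvgn.
    by apply/nondecreasing_series => n _ _; exact: sqm_ge0.
  by exists (1 ^+ 2) => _ [N _ <-]; exact: AA.
apply: (cvgP (L2 g2)); apply/cvgrPdist_le => e e0.
have [r r0 er] : exists2 r : R, 0 < r & e = r%:C.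
  exists (complex.Re e); last by rewrite RRe_real // gtr0_real.
  by rewrite -ltcR RRe_real // gtr0_real.
have [A FA AA] := key r r0.
apply: filterS FA => f Af; rewrite -normrN opprB er.
by apply/(l2_norm_leP _ (ltW r0)) => N; exact: AA.
Qed.

HB.instance Definition _ := Uniform_isComplete.Build (l2 R) l2_complete.

Definition l2_hilbert : hilbertType R :=
  @HilbertType R (l2 R) (@l2dot R) (@l2norm_sqr R).
End L2complete.

(** * Isometries and their Moebius transforms *)

Definition linear_pack (R : nzRingType) (U V : lmodType R) (f : U -> V)
    (fL : linear f) : {linear U -> V} :=
  HB.pack f (GRing.isLinear.Build R U V *:%R f fL).

Section Isometry.
Variables (R : realType) (K : hilbertType R).
Local Notation C := R[i].
Implicit Types (T S X : {linear K -> K}) (mu lambda : C).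

Lemma isometry_continuous T : isometry_op T -> continuous T.
Proof.
move=> Ti x; apply/cvgrPdist_lt => e e0.
apply/nbhs_ballP; exists e => // y; rewrite -ball_normE /=.
by rewrite -linearB /= Ti.
Qed.

Lemma expr_norm_small mu (b e : C) : `|mu| < 1 -> 0 <= b -> 0 < e ->
  exists n, `|mu| ^+ n * b < e.
Proof.
move=> mu1 b0 e0.
have /esym qE : (complex.Re `|mu|)%:C = `|mu| by rewrite RRe_real ?normr_real.
have /esym bE : (complex.Re b)%:C = b by rewrite RRe_real ?ger0_real.
have /esym eE : (complex.Re e)%:C = e by rewrite RRe_real ?gtr0_real.
set q := complex.Re `|mu| in qE; set b' := complex.Re b in bE.
have q1 : `|q| < 1.
  have q0 : 0 <= q by rewrite -ler0c -qE.
  by rewrite ger0_norm // -ltcR -qE.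
have /cvgrPdist_lt/(_ (complex.Re e)) := cvg_geometric b' q1.
rewrite -ltcR -eE => /(_ e0) [n _ /(_ n (leqnn n))] /=.
rewrite sub0r normrN /geometric /= => /(le_lt_trans (ler_norm _)) bq.
by exists n; rewrite qE bE eE -rmorphXn -rmorphM ltcR mulrC.
Qed.

Lemma isometry_resolvent_inj T mu (x : K) : isometry_op T -> `|mu| < 1 ->
  x + mu *: T x = 0 -> x = 0.
Proof.
move=> Ti mu1 /eqP; rewrite addr_eq0 => /eqP E; apply/normr0_eq0.
have : `|x| = `|mu| * `|x| by rewrite {1}E normrN normrZ Ti.
have [//|x0] := eqVneq `|x| 0; move/eqP; rewrite -{1}[`|x|]mul1r.
by move/eqP/(mulIf x0) => m1; rewrite -m1 ltxx in mu1.
Qed.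

(** The solution is the fixed point of [phi], a contraction of ratio |mu| iterated from 0. The bound
    |y| / (1 - |mu|) on the iterates is preserved by [phi], and it makes them a Cauchy sequence. *)
Lemma isometry_resolvent_surj T mu (y : K) : isometry_op T -> `|mu| < 1 ->
  exists x, x + mu *: T x = y.
Proof.
move=> Ti mu1.
pose phi (x : K) := y - mu *: T x.
pose x_ n := iter n phi 0.
have x_le n : `|x_ n| <= `|y| / (1 - `|mu|).
  have d0 : 0 < 1 - `|mu| by rewrite subr_gt0.
  elim: n => [|n IH]; first by rewrite normr0 divr_ge0 // ltW.
  rewrite /x_ /= -/(x_ n) /phi (le_trans (ler_normB _ _)) // normrZ Ti.
  apply: (@le_trans _ _ (`|y| + `|mu| * (`|y| / (1 - `|mu|)))).
    by rewrite lerD2l ler_wpM2l.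
  rewrite -[X in X + _](divfK (lt0r_neq0 d0)).
  by rewrite mulrBr mulr1 [`|mu| * _]mulrC subrK.
have x_diff k n : `|x_ (n + k)%N - x_ n| = `|mu| ^+ n * `|x_ k|.
  elim: n => [|n IH]; first by rewrite subr0 mul1r.
  have phiB a b : phi a - phi b = mu *: T (b - a).
    by rewrite (raddfB T) scalerBr /phi opprB addrC addrA subrK.
  rewrite addSn [x_ _.+1]iterS [x_ n.+1]iterS phiB normrZ Ti distrC IH.
  by rewrite exprS mulrA.
have cx : cvg (x_ @ \oo).
  apply/cauchy_cvgP/cauchy_exP => e e0.
  have B0 : 0 <= `|y| / (1 - `|mu|) by rewrite divr_ge0 // subr_ge0 ltW.
  have [n ne] := expr_norm_small mu1 B0 e0.
  exists (x_ n); exists n => // m /= nm.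
  rewrite -ball_normE /= -normrN opprB -(subnKC nm) x_diff.
  by apply: le_lt_trans ne; rewrite ler_wpM2l ?exprn_ge0.
exists (lim (x_ @ \oo)).
have phi_cvg : (fun n => phi (x_ n)) @ \oo --> phi (lim (x_ @ \oo)).
  apply: cvgB; first exact: cvg_cst.
  apply: cvgZr; apply: continuous_cvg cx; exact: isometry_continuous.
have : (fun n => x_ n.+1) @ \oo --> lim (x_ @ \oo) by rewrite cvg_shiftS.
move/(cvg_unique (@norm_hausdorff _ K) phi_cvg) => E.
by rewrite -{1}E /phi subrK.
Qed.

(* For [`|lambda| < 1], [S = (T + lambda) (1 + conj lambda T)^-1]. *)
Lemma moebius_isometry T lambda : isometry_op T -> `|lambda| <= 1 ->
  exists S, [/\ isometry_op S,
    forall X, commuting_op T X -> commuting_op S X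
    & forall n (P : {linear K -> 'cV[C]_n}) (N : 'M[C]_n), N *m N = 0 ->
      (forall x, P (T x) = N *m P x) ->
      forall x, P (S x) = (lambda%:M + (1 - `|lambda| ^+ 2) *: N) *m P x].
Proof.
move=> Ti; rewrite le_eqVlt => /predU1P[l1|l1].
  (* On the unit circle the factor 1 - |lambda|^2 kills the nilpotent part, so the scalar operator
     [lambda] is enough. *)
  have SL : linear (fun x : K => lambda *: x).
    by move=> a x y; rewrite scalerDr !scalerA [lambda * a]mulrC.
  exists (linear_pack SL); split=> [x|X _ x|n P N _ _ x].
  - by rewrite /= normrZ l1 mul1r.
  - by rewrite /= linearZ.
  - by rewrite /= l1 expr1n subrr scale0r addr0 mul_scalar_mx linearZ.
pose mu := Num.conj lambda.
have mu1 : `|mu| < 1 by rewrite norm_conjC.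
pose B (y : K) : K := projT1 (cid (isometry_resolvent_surj y Ti mu1)).
have BE y : B y + mu *: T (B y) = y by rewrite /B; case: cid.
(* Uniqueness of the solution characterises [B], the inverse of 1 + mu T; its linearity and its
   commutation properties follow. *)
have BP x y : x + mu *: T x = y -> B y = x.
  move=> xy; apply/eqP; rewrite -subr_eq0; apply/eqP.
  apply: (isometry_resolvent_inj Ti mu1).
  by rewrite (raddfB T) scalerBr addrACA -opprD BE xy subrr.
have BL : linear B.
  move=> a x y; apply: BP.
  rewrite linearP scalerDr addrACA scalerA [mu * a]mulrC -scalerA -scalerDr.
  by rewrite !BE.
have SL : linear (fun y => lambda *: B y + T (B y)).
  move=> a x y; rewrite BL (linearP T) !scalerDr !scalerA [a * _]mulrC.
  by rewrite addrACA.
exists (linear_pack SL); split=> [y|X TX y|n P N NN PT y] /=.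
(* Put z = B y. Since |T z| = |z|, the vectors lambda z + T z and z + mu T z have the same diagonal
   terms, and their cross terms agree because [mu] is the conjugate of [lambda]. *)
- have dE : hdot K (lambda *: B y + T (B y)) (lambda *: B y + T (B y)) =
      hdot K y y.
    rewrite -[in RHS](BE y) !dnormD !dnormZ norm_conjC.
    have -> : hdot K (T (B y)) (T (B y)) = hdot K (B y) (B y).
      by rewrite -!hdot_norm Ti.
    rewrite linearZl_LR linearZr_LR /= conjCK.
    by rewrite [X in X + _]addrC.
  by apply/eqP; rewrite -(eqrXn2 (n:=2)) // !hdot_norm dE.
- have -> : B (X y) = X (B y).
    by apply: BP; rewrite TX -linearZ -linearD BE.
  by rewrite TX linearD linearZ.
(* With D = 1 - |lambda|^2, the claim reduces to (lambda + D N)(1 + mu N) = lambda + N, which holds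
   because N^2 = 0 and lambda mu = |lambda|^2. *)
- have Py : P y = mu *: (N *m P (B y)) + P (B y).
    by rewrite -PT -(linearP P mu) addrC BE.
  rewrite (linearP P) PT Py mulmxDl !mulmxDr !mul_scalar_mx.
  rewrite -!scalemxAl -!scalemxAr.
  rewrite mulmxA NN mul0mx !scaler0 add0r scalerA -normCK -addrA.
  by rewrite [RHS]addrCA -scalerDl [_ + (1 - _)]addrC subrK scale1r addrC.
Qed.

(** The map [P] is the adjoint of [V], so its kernel is the orthogonal complement of the range of
    [V]. The relation P S = A P is the adjoint of S^* V = V A^*, that is, the coextension
    property. *)
Lemma coextension_intertwine n (V : {linear 'cV[C]_n -> K})
    (P : {linear K -> 'cV[C]_n}) (A : 'M[C]_n) S :
  isometric_embedding V -> (forall k h, hdot K k (V h) = cvdot (P k) h) ->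
  isometry_op S -> (forall k, P (S k) = A *m P k) -> coextension V A S.
Proof.
move=> Vi VP Si PS.
have PV x : P (V x) = x by apply: cvdot_inj => h; rewrite -VP Vi.
split=> [|x|k kV _ [h _ <-]].
- exact: isometry_continuous.
- exists (S (V x) - V (A *m x)); last by rewrite addrC subrK.
  move=> _ [h _ <-]; rewrite VP raddfB /= PS !PV subrr.
  exact: cvdot0l.
- have Pk : P k = 0.
    apply: cvdot_inj => g; rewrite -VP kV; last by exists g.
    by rewrite cvdot0l.
  by rewrite VP PS Pk mulmx0 cvdot0l.
Qed.
End Isometry.

(** * Commuting weighted shifts attached to a frame *)

Section WeightedShift.
Variable R : realType.
Local Notation C := R[i].
(** The nilpotents will map the first [p] vectors of the Parseval frame [b] into the span of the
    last [m], and annihilate the latter. The matrix [Q] embeds C^p isometrically in C^m. *)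
Variables (n p m : nat) (b : nat -> 'cV[C]_n) (Q : nat -> nat -> C).
Hypothesis b_parseval : forall x : 'cV[C]_n,
  \sum_(k < p + m) cvdot x (b k) *: b k = x.
Hypothesis Q_isometry : forall x : nat -> C,
  \sum_(k < m) `|\sum_(j < p) Q k j * x j| ^+ 2 = \sum_(j < p) `|x j| ^+ 2.

Definition analysis_fun (x : 'cV[C]_n) (k : nat) : C :=
  if (k < p + m)%N then cvdot x (b k) else 0.

Lemma finite_l2 (f : nat -> C) N : (forall k, (N <= k)%N -> f k = 0) ->
  f \in @l2_pred R.
Proof.
move=> f0; apply/l2_predP; apply: cvgP; apply: (series_finite_cvg (N := N)).
by move=> k /f0 ->; rewrite /sqm /= expr0n addr0.
Qed.

Lemma analysis_l2 x : analysis_fun x \in @l2_pred R.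
Proof.
apply: (@finite_l2 _ (p + m)) => k pmk.
by rewrite /analysis_fun ltnNge pmk.
Qed.

Definition analysis (x : 'cV[C]_n) : l2 R := L2 (analysis_l2 x).

Lemma analysis_linear : linear analysis.
Proof.
move=> a x y; apply/val_inj/funext => k /=.
change (analysis_fun (a *: x + y) k = a * analysis_fun x k + analysis_fun y k).
by rewrite /analysis_fun cvdotDZl; case: ifP => // _; rewrite mulr0 addr0.
Qed.

Definition synthesis (f : l2 R) : 'cV[C]_n := \sum_(k < p + m) f k *: b k.

Lemma synthesis_linear : linear synthesis.
Proof.
move=> a f g; rewrite /synthesis scaler_sumr -big_split /=.
by apply: eq_bigr => k _; rewrite scalerA -scalerDl.
Qed.

Lemma analysis_adjoint f h : l2dot f (analysis h) = cvdot (synthesis f) h.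
Proof.
rewrite /l2dot (@csum_finite _ _ (p + m)) => [|k pmk]; last first.
  by rewrite /analysis /= /analysis_fun ltnNge pmk rmorph0 mulr0.
rewrite /synthesis (big_morph (fun x => cvdot x h) (id1 := 0) (op1 := +%R)).
- apply: eq_bigr => k _; rewrite /analysis /= /analysis_fun ltn_ord.
  have conjK (z : C) : (Num.conj z)^*%C = z by exact: conjcK.
  by rewrite cvdotZl [cvdot h _]cvdotC conjK.
- by move=> x y; exact: cvdotDl.
- exact: cvdot0l.
Qed.

Lemma synthesisK x : synthesis (analysis x) = x.
Proof.
rewrite -[RHS]b_parseval; apply: eq_bigr => k _.
by rewrite /= /analysis_fun ltn_ord.
Qed.

(* A sequence is read as a vector of C^p (+) C^m (+) C^m (+) ..., on which
   [wshift] maps (y, x0, x1, ...) to (0, D Q y, D x0, D x1, ...), where D is the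
   diagonal matrix with entries d 0, ..., d m.-1. *)
Definition wshift_fun (d : nat -> C) (f : nat -> C) (k : nat) : C :=
  if (k < p)%N then 0 else
  d ((k - p) %% m)%N *
    (if (k < p + m)%N then \sum_(j < p) Q (k - p) j * f j else f (k - m)%N).

(** The [p] leading zeros contribute nothing, the next [m] terms carry the mass of the first [p]
    entries since [Q] is isometric, and the others are moved by [m] places. Hence the offset [m]
    between the partial sums. *)
Lemma wshift_series (d : nat -> C) f N : (forall k, `|d k| = 1) ->
  series (fun k => sqm (wshift_fun d f k)) (N + (p + m))%N =
  series (fun k => sqm (f k)) (N + p)%N.
Proof.
move=> d1; rewrite /series /= !big_mkord [in LHS]addnC -addnA [in RHS]addnC.
rewrite !big_split_ord /= big1 ?add0r => [|k _]; last first.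
  by rewrite /wshift_fun ltn_ord /sqm /= expr0n addr0.
congr (_ + _).
  apply: complexI; rewrite !rmorph_sum /=.
  under [RHS]eq_bigr do rewrite sqm_normE.
  rewrite -(Q_isometry f); apply: eq_bigr => k _.
  rewrite /wshift_fun ltnNge leq_addr /= ltn_add2l ltn_ord addKn.
  by rewrite sqm_unimodular // sqm_normE.
apply: eq_bigr => k _.
rewrite /wshift_fun ltnNge leq_addr /= addnA ltnNge leq_addr /=.
by rewrite sqm_unimodular // addnAC addnK.
Qed.

Lemma wshift_cvg (d : nat -> C) (f : l2 R) : (forall k, `|d k| = 1) ->
  series (fun k => sqm (wshift_fun d f k)) @ \oo -->
  limn (series (fun k => sqm (f k))).
Proof.
move=> d1; have /l2_predP := l2_valP f; rewrite -(cvg_shiftn p) => cf.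
rewrite -(cvg_shiftn (p + m)); apply: cvg_trans cf.
by apply: near_eq_cvg; apply: nearW => k /=; rewrite wshift_series.
Qed.

Lemma wshift_l2 (d : nat -> C) (f : l2 R) : (forall k, `|d k| = 1) ->
  wshift_fun d f \in @l2_pred R.
Proof. by move=> d1; apply/l2_predP; apply: cvgP; exact: wshift_cvg. Qed.

Definition wshift d (d1 : forall k, `|d k| = 1) f : l2 R := L2 (wshift_l2 f d1).

Lemma wshift_linear d (d1 : forall k, `|d k| = 1) : linear (wshift d1).
Proof.
move=> a f g; apply/val_inj/funext => k /=.
change (wshift_fun d (fun k => a * f k + g k) k =
  a * wshift_fun d f k + wshift_fun d g k).
rewrite /wshift_fun; case: ifP => _; first by rewrite mulr0 addr0.
rewrite mulrCA -mulrDr; congr (_ * _); case: ifP => // _.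
rewrite mulr_sumr -big_split /=; apply: eq_bigr => j _.
by rewrite mulrDr mulrCA.
Qed.

Lemma wshift_isometry d (d1 : forall k, `|d k| = 1) f : `|wshift d1 f| = `|f|.
Proof.
apply/eqP; rewrite -(eqrXn2 (n:=2)) // !l2norm_sqr !l2dotE; apply/eqP.
by congr (_%:C); apply: cvg_lim => //; exact: wshift_cvg.
Qed.

(** The weight at [k] depends only on k - p modulo [m], which a move by [m] places preserves, so two
    shifts multiply their weights at the same residue. *)
Lemma wshift_comm d e
    (d1 : forall k, `|d k| = 1) (e1 : forall k, `|e k| = 1) f :
  wshift d1 (wshift e1 f) = wshift e1 (wshift d1 f).
Proof.
have main u v k : wshift_fun u (wshift_fun v f) k =
    if (k < p + m)%N then 0 else u ((k - p) %% m)%N * v ((k - p) %% m)%N *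
    (if (k - m < p + m)%N then \sum_(j < p) Q (k - m - p) j * f j
     else f (k - m - m)%N).
  rewrite {1}/wshift_fun; case: ltnP => kp; first by rewrite ltn_addr.
  case: ltnP => kpm.
    (* The outer shift applies [Q] to the first [p] entries of a shifted sequence, which are
       zero. *)
    rewrite big1 ?mulr0 // => j _.
    by rewrite /wshift_fun ltn_ord mulr0.
  have pkm : (p <= k - m)%N.
    by rewrite leq_subRL ?(leq_trans _ kpm) ?leq_addl // addnC.
  rewrite /wshift_fun ltnNge pkm /= mulrA.
  rewrite (_ : (k - m - p) %% m = (k - p) %% m)%N //.
  by rewrite subnAC -[in RHS](@subnK m (k - p)) ?modnDr // leq_subRL.
by apply/val_inj/funext => k /=; rewrite !main [d _ * _]mulrC.
Qed.

(** Only the first p + m entries are synthesised. The block of [f] at positions p to p + m - 1 is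
    shifted out of this range, in agreement with [N] killing the corresponding vectors of [b]. *)
Lemma wshift_synthesis (d : nat -> C) (d1 : forall k, `|d k| = 1)
    (N : 'M[C]_n) :
  (forall k, (k < m)%N -> N *m b (p + k) = 0) ->
  (forall j, (j < p)%N -> N *m b j = \sum_(k < m) (d k * Q k j) *: b (p + k)) ->
  forall f, synthesis (wshift d1 f) = N *m synthesis f.
Proof.
move=> Nb0 Nb f; rewrite /synthesis mulmx_sumr !big_split_ord /=.
rewrite big1 ?add0r => [|j _]; last by rewrite /wshift_fun ltn_ord scale0r.
rewrite [X in _ = _ + X]big1 ?addr0 => [|k _]; last first.
  by rewrite -scalemxAr Nb0 // scaler0.
under [RHS]eq_bigr => j _ do rewrite -scalemxAr Nb // scaler_sumr.
rewrite exchange_big /=; apply: eq_bigr => k _.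
rewrite /wshift_fun ltnNge leq_addr /= ltn_add2l ltn_ord addKn modn_small //.
rewrite mulr_sumr scaler_suml; apply: eq_bigr => j _.
by rewrite scalerA; congr (_ *: _); rewrite mulrA mulrC.
Qed.

Lemma coextension_of_frame (I : Type) (A N : I -> 'M[C]_n) (lambda : I -> C)
    (d : I -> nat -> C) :
  (forall i k, `|d i k| = 1) ->
  (forall i, `|lambda i| <= 1) ->
  (forall i, N i *m N i = 0) ->
  (forall i, A i = (lambda i)%:M + (1 - `|lambda i| ^+ 2) *: N i) ->
  (forall i k, (k < m)%N -> N i *m b (p + k) = 0) ->
  (forall i j, (j < p)%N ->
    N i *m b j = \sum_(k < m) (d i k * Q k j) *: b (p + k)) ->
  exists (K : hilbertType R) (V : {linear 'cV[C]_n -> K})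
         (S : I -> {linear K -> K}),
    [/\ isometric_embedding V,
        forall i j : I, commuting_op (S i) (S j),
        forall i : I, isometry_op (S i)
      & forall i : I, coextension V (A i) (S i)].
Proof.
move=> d1 l1 NN AE Nb0 Nb.
pose K := l2_hilbert R.
pose V : {linear 'cV[C]_n -> K} := linear_pack analysis_linear.
pose P : {linear K -> 'cV[C]_n} := linear_pack synthesis_linear.
pose T i : {linear K -> K} := linear_pack (wshift_linear (d1 i)).
have Ti i : isometry_op (T i) by move=> x; exact: wshift_isometry.
have TC i j : commuting_op (T i) (T j) by move=> x; exact: wshift_comm.
pose S i := projT1 (cid (moebius_isometry (Ti i) (l1 i))).
have SP i : [/\ isometry_op (S i),
    forall X : {linear K -> K}, commuting_op (T i) X -> commuting_op (S i) X
    & forall n (P : {linear K -> 'cV[C]_n}) (N : 'M[C]_n), N *m N = 0 ->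
      (forall x, P (T i x) = N *m P x) -> forall x, P (S i x) =
      ((lambda i)%:M + (1 - `|lambda i| ^+ 2) *: N) *m P x].
  by rewrite /S; case: cid.
have VP k h : hdot K k (V h) = cvdot (P k) h by exact: analysis_adjoint.
have Vi : isometric_embedding V by move=> x y; rewrite VP /= synthesisK.
exists K, V, S; split=> // [i j|i|i].
- have [_ Si _] := SP i; have [_ Sj _] := SP j.
  (* Commutation is transferred twice: from [T j] to [S j] against [T i], then from [T i] to [S i]
     against [S j]. *)
  apply: Si => x; apply/esym; apply: Sj => y; exact: TC.
- by have [] := SP i.
- have [Si _ SN] := SP i.
  apply: (coextension_intertwine Vi VP Si) => k; rewrite AE.
  apply: SN => // x; apply: wshift_synthesis; [exact: Nb0 | exact: Nb].
Qed.
End WeightedShift.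

(** * Commuting families of square-zero matrices *)

Section SquareZero.
Variable R : realType.
Local Notation C := R[i].
Local Notation conj := (@Num.conj C).

(** The range lies in the kernel, so twice the rank is at most 3. *)
Lemma square_zero_outer (N : 'M[C]_3) : N *m N = 0 ->
  exists (u : 'cV[C]_3) (v : 'rV[C]_3), N = u *m v.
Proof.
move=> /mulmx0_rank_max rN; apply: rank1_outer.
by case: (\rank N) rN => [|[|k]] //; rewrite !addSn !addnS.
Qed.

Lemma col_row_eq0 n (u : 'cV[C]_n) (v : 'rV[C]_n) :
  u *m v = 0 -> u = 0 \/ v = 0.
Proof.
move=> uv0; have [->|/eqP/colP u0] := eqVneq u 0; [by left|right].
apply/rowP => l; rewrite mxE; apply: contrapT => /eqP v0; apply: u0 => k.
have /matrixP/(_ k l) := uv0; rewrite !mxE big_ord1 => /eqP.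
by rewrite mulf_eq0 (negPf v0) orbF => /eqP.
Qed.

(** The two products are a (u v') and a' (u' v). If neither scalar vanishes, then 0 = N (N N') = N
    (N' N) = a a' N, so N = 0. *)
Lemma mulmx_rank1_comm n (u u' : 'cV[C]_n) (v v' : 'rV[C]_n) :
  let N := u *m v in let N' := u' *m v' in
  N *m N = 0 -> N' *m N' = 0 -> N *m N' = N' *m N -> N *m N' = 0.
Proof.
move=> N N' NN N'N' NN'.
pose a := (v *m u') 0 0; pose a' := (v' *m u) 0 0.
have aE : v *m u' = a%:M by rewrite [LHS]mx11_scalar.
have a'E : v' *m u = a'%:M by rewrite [LHS]mx11_scalar.
have E : N *m N' = a *: (u *m v').
  by rewrite /N /N' mulmxA -[u *m v *m u']mulmxA aE mul_mx_scalar scalemxAl.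
have E' : N' *m N = a' *: (u' *m v).
  by rewrite /N /N' mulmxA -[u' *m v' *m u]mulmxA a'E mul_mx_scalar scalemxAl.
have [a0|a0] := eqVneq a 0; first by rewrite E a0 scale0r.
have [a'0|a'0] := eqVneq a' 0; first by rewrite NN' E' a'0 scale0r.
have : N *m (N *m N') = 0 by rewrite mulmxA NN mul0mx.
rewrite NN' E' -scalemxAr /N mulmxA -[u *m v *m u']mulmxA aE mul_mx_scalar.
rewrite -scalemxAl scalerA => /eqP; rewrite scaler_eq0 mulf_eq0.
rewrite (negPf a0) (negPf a'0) => /= /eqP N0.
by rewrite -E' /N N0 mulmx0.
Qed.

(* Stacking the rows v i and the columns u j into square matrices with product
   zero, one of the two has rank at most 1. *)
Lemma square_zero_family (N : 'I_3 -> 'M[C]_3) :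
  (forall i, N i *m N i = 0) -> (forall i j, N i *m N j = N j *m N i) ->
  (exists c : 'cV[C]_3, forall i, exists v : 'rV[C]_3, N i = c *m v) \/
  (exists r : 'rV[C]_3, forall i, exists u : 'cV[C]_3, N i = u *m r).
Proof.
move=> NN Ncomm.
(* A zero matrix receives zero factors, so that [v i *m u j = 0] holds for all pairs, including
   those with a zero matrix. *)
have uvP i : exists uv : 'cV[C]_3 * 'rV[C]_3,
    N i = uv.1 *m uv.2 /\ (N i = 0 -> uv.1 = 0 /\ uv.2 = 0).
  have [N0|N0] := eqVneq (N i) 0.
    by exists (0, 0); rewrite N0 mul0mx.
  have [u [v E]] := square_zero_outer (NN i).
  by exists (u, v); split=> // N0'; rewrite N0' eqxx in N0.
pose uv i := projT1 (cid (uvP i)).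
pose u i := (uv i).1; pose v i := (uv i).2.
have NE i : N i = u i *m v i by rewrite /u /v /uv; case: cid => x [].
have N0 i : N i = 0 -> u i = 0 /\ v i = 0.
  by rewrite /u /v /uv; case: cid => x [].
have vu i j : v i *m u j = 0.
  have [Ni0|Ni0] := eqVneq (N i) 0; first by rewrite (N0 i Ni0).2 mul0mx.
  have [Nj0|Nj0] := eqVneq (N j) 0; first by rewrite (N0 j Nj0).1 mulmx0.
  have : N i *m N j = 0.
    have := Ncomm i j; have := NN i; have := NN j; rewrite !NE => *.
    exact: mulmx_rank1_comm.
  rewrite !NE mulmxA -[u i *m v i *m u j]mulmxA [v i *m u j]mx11_scalar.
  rewrite mul_mx_scalar -scalemxAl => /eqP.
  rewrite scaler_eq0 => /orP[/eqP ->|].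
    by rewrite raddf0.
  case/eqP/col_row_eq0 => [u0|v0].
    by rewrite NE u0 mul0mx eqxx in Ni0.
  by rewrite NE v0 mulmx0 eqxx in Nj0.
pose V : 'M[C]_3 := \matrix_i v i.
pose U : 'M[C]_3 := \matrix_(k, j) u j k 0.
have VU : V *m U = 0.
  apply/matrixP => i j; rewrite [LHS]mxE [RHS]mxE.
  have /matrixP/(_ 0 0) := vu i j; rewrite [LHS]mxE [RHS]mxE => E.
  rewrite -[RHS]E.
  by apply: eq_bigr => k _; rewrite !mxE.
have := mulmx0_rank_max VU.
have [V1|V2] := leqP (\rank V) 1 => rVU.
  right; have [c [r E]] := rank1_outer V1; exists r => i.
  exists (c i 0 *: u i); rewrite NE -scalemxAl scalemxAr; congr (_ *m _).
  apply/rowP => k; have /matrixP/(_ i k) := E.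
  by rewrite !mxE big_ord1.
have U1 : (\rank U <= 1)%N.
  by rewrite -(leq_add2l (\rank V)) (leq_trans rVU) // addn1.
left; have [c [r E]] := rank1_outer U1; exists c => j.
exists (r 0 j *: v j); rewrite NE -scalemxAr scalemxAl; congr (_ *m _).
apply/colP => k; have /matrixP/(_ k j) := E.
by rewrite !mxE big_ord1 mulrC.
Qed.
(** With y the adjoint of [v], N^2 e = (cvdot e y)^2 e, so N^2 = 0 forces y to be orthogonal to [e];
    [w] and [s] are its direction and its length. If y = 0, any unit [w] orthogonal to [e] serves,
    with s = 0. *)
Lemma outer_form (e : 'cV[C]_3) (N : 'M[C]_3) (v : 'rV[C]_3) :
  cvdot e e = 1 -> N *m N = 0 -> N = e *m v ->
  exists (w : 'cV[C]_3) (s : C),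
    [/\ cvdot w w = 1, cvdot w e = 0, 0 <= s & N = s *: outer e w].
Proof.
move=> ee NN NE.
have [y0|y0] := eqVneq (ctmx v) 0.
  have [w [ww we _]] := exists_unit_perp e e (leqnn 3).
  exists w, 0; split=> //; rewrite scale0r NE -(ctmxK v) y0.
  by rewrite /ctmx map_mx0 trmx0 mulmx0.
set y := ctmx v in y0.
have {}NE : N = outer e y by rewrite /outer ctmxK.
have ey : cvdot e y = 0.
  apply/eqP; rewrite -sqrf_eq0 expr2; apply/eqP.
  have : N *m N *m e = 0 by rewrite NN mul0mx.
  rewrite NE -mulmxA !outerE cvdotZl => E.
  by rewrite -[LHS]mulr1 -ee -cvdotZl E cvdot0l.
have [s_gt0 sE w1] := cvdot_normalize y0; set s := sqrtC _ in s_gt0 sE w1.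
have sJ : conj s = s by rewrite conj_Creal ?gtr0_real.
exists (s^-1 *: y), s; split=> //; last first.
  rewrite /outer ctmxZ fmorphV /= sJ -scalemxAr scalerA divff ?gt_eqF //.
  by rewrite scale1r.
  exact: ltW.
by rewrite cvdotZl [cvdot y e]cvdotC ey conjC0 mulr0.
Qed.

Lemma common_range_outer (N : 'I_3 -> 'M[C]_3) (c : 'cV[C]_3) :
  (forall i, N i *m N i = 0) -> (forall i, exists v : 'rV[C]_3, N i = c *m v) ->
  exists (e : 'cV[C]_3) (w : 'I_3 -> 'cV[C]_3) (s : 'I_3 -> C),
    cvdot e e = 1 /\
    forall i, [/\ cvdot (w i) (w i) = 1, cvdot (w i) e = 0, 0 <= s i
                & N i = s i *: outer e (w i)].
Proof.
move=> NN Nc.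
have [e [ee eP]] : exists e : 'cV[C]_3, cvdot e e = 1 /\
    forall i, exists v : 'rV[C]_3, N i = e *m v.
  have [c0|c0] := eqVneq c 0.
    have [e [ee _ _]] := exists_unit_perp (0 : 'cV[C]_3) 0 (leqnn 3).
    exists e; split=> // i; exists 0; have [v ->] := Nc i.
    by rewrite c0 mul0mx mulmx0.
  have [s_gt0 _ e1] := cvdot_normalize c0; set s := sqrtC _ in s_gt0 e1.
  exists (s^-1 *: c); split=> // i; have [v ->] := Nc i; exists (s *: v).
  by rewrite -scalemxAr -scalemxAl scalerA divff ?gt_eqF // scale1r.
have wsP i : exists ws : 'cV[C]_3 * C, [/\ cvdot ws.1 ws.1 = 1,
    cvdot ws.1 e = 0, 0 <= ws.2 & N i = ws.2 *: outer e ws.1].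
  have [v NE] := eP i; have [w [s P]] := outer_form ee (NN i) NE.
  by exists (w, s).
pose ws i := projT1 (cid (wsP i)).
exists e, (fun i => (ws i).1), (fun i => (ws i).2); split=> // i.
by rewrite /ws; case: cid.
Qed.

(** A common row becomes a common column after taking adjoints, which exchanges the two arguments of
    [outer]. *)
Lemma square_zero_family_outer (N : 'I_3 -> 'M[C]_3) :
  (forall i, N i *m N i = 0) -> (forall i j, N i *m N j = N j *m N i) ->
  exists (e : 'cV[C]_3) (w : 'I_3 -> 'cV[C]_3) (s : 'I_3 -> C),
    [/\ cvdot e e = 1,
      forall i, [/\ cvdot (w i) (w i) = 1, cvdot (w i) e = 0 & 0 <= s i]
    & (forall i, N i = s i *: outer e (w i)) \/
      (forall i, N i = s i *: outer (w i) e)].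
Proof.
move=> NN Ncomm; have [[c Nc]|[r Nr]] := square_zero_family NN Ncomm.
  have [e [w [s [ee P]]]] := common_range_outer NN Nc.
  exists e, w, s; split=> // [i|]; first by have [] := P i.
  by left => i; have [] := P i.
have MM i : ctmx (N i) *m ctmx (N i) = 0.
  by rewrite -ctmxM NN /ctmx map_mx0 trmx0.
have Mc i : exists v : 'rV[C]_3, ctmx (N i) = ctmx r *m v.
  by have [u ->] := Nr i; exists (ctmx u); rewrite ctmxM.
have [e [w [s [ee P]]]] := common_range_outer MM Mc.
exists e, w, s; split=> // [i|]; first by have [] := P i.
right => i; have [_ _ s0 NE] := P i.
by rewrite -[N i]ctmxK NE ctmxZ ctmx_outer conj_Creal // ger0_real.
Qed.
End SquareZero.

(** * A unimodular frame for three vectors in a plane *)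

Section TwoPoint.
Variable C : numClosedFieldType.
Local Notation conj := (@Num.conj C).

(** The unit [nu] is the direction of [delta] turned by a right angle. *)
Lemma perp_direction (delta : C) : exists nu : C,
  `|nu| = 1 /\ delta * conj nu + conj delta * nu = 0.
Proof.
have [->|d0] := eqVneq delta 0.
  by exists 1; rewrite normr1 mul0r conjC0 mul0r addr0.
exists ('i * delta / `|delta|); split.
  by rewrite !normrM normCi mul1r normfV normr_id divff // normr_eq0.
have iJ : conj 'i%R = - 'i%R by exact: conjCi.
have dJ : conj `|delta| = `|delta| by exact: conj_Creal (normr_real _).
rewrite !rmorphM fmorphV /= iJ dJ; ring.
Qed.

(** Each root is weighted in proportion to the modulus of the other, which gives mean 0; the second
    moment is then minus the product of the roots, namely 1. *)
Lemma unit_quadratic_roots (c : C) : c \is Num.real -> exists (t p : bool -> C),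
  [/\ forall k, t k \is Num.real /\ t k ^+ 2 + c * t k = 1,
      forall k, 0 <= p k, p true + p false = 1,
      p true * t true + p false * t false = 0
    & p true * t true ^+ 2 + p false * t false ^+ 2 = 1].
Proof.
move=> cR; pose s := sqrtC (c ^+ 2 + 4).
have c2 : 0 <= c ^+ 2 by rewrite real_exprn_even_ge0.
have s_gt0 : 0 < s by rewrite sqrtC_gt0 ltr_wpDl // ltr0n.
have sE : s ^+ 2 = c ^+ 2 + 4 by rewrite sqrtCK.
have cs : `|c| <= s.
  by rewrite -ler_sqr ?nnegrE ?(ltW s_gt0) // sE real_normK // lerDl ler0n.
have sR : s \is Num.real by rewrite gtr0_real.
have [c1 c3] : 0 <= s + c /\ 0 <= s - c.
  rewrite -lerBlDl sub0r subr_ge0; split; last first.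
    exact: le_trans (real_ler_norm cR) cs.
  by rewrite lerNl; apply: le_trans cs; rewrite -normrN real_ler_norm // rpredN.
have s0 : s != 0 by rewrite gt_eqF.
exists (fun k => if k then (s - c) / 2 else - (s + c) / 2).
exists (fun k => if k then (s + c) / (2 * s) else (s - c) / (2 * s)).
(* Replacing 1 by this expression turns the remaining equations into rational identities in [s] and
   [c], free of the relation between them. *)
have scE : (s ^+ 2 - c ^+ 2) / 4 = 1.
  by rewrite sE addrAC subrr add0r divff // pnatr_eq0.
have q1 : ((s - c) / 2) ^+ 2 + c * ((s - c) / 2) = 1.
  by rewrite -[RHS]scE; field.
have q2 : (- (s + c) / 2) ^+ 2 + c * (- (s + c) / 2) = 1.
  by rewrite -[RHS]scE; field.
split.
- have hR (x : C) : x \is Num.real -> x / 2 \is Num.real.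
    by move=> xR; apply: rpred_div => //; exact: realn.
  case; split=> //; apply: hR; first exact: rpredB.
  by rewrite rpredN; exact: rpredD.
- by case; rewrite divr_ge0 // mulr_ge0 ?ler0n ?(ltW s_gt0).
- by field; rewrite s0.
- by field; rewrite s0.
- by rewrite -[RHS]scE; field; rewrite s0.
Qed.

(* We take [z k = t k * nu], where the unit [nu] is chosen so that
   [c = 2 Re (al j / be j * conj nu)] is the same for both [j], and [t k] are
   the roots of [t^2 + c t = 1]; their product is -1, so they admit weights of
   mean 0 and variance 1. If [be j = 0], the quotient is 0 and the condition
   on [j] is void. *)
Lemma two_point (al be : bool -> C) : exists p z : bool -> C,
  [/\ forall k, 0 <= p k, p true + p false = 1,
      p true * z true + p false * z false = 0,
      p true * `|z true| ^+ 2 + p false * `|z false| ^+ 2 = 1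
    & forall j k, `|al j + be j * z k| ^+ 2 = `|al j| ^+ 2 + `|be j| ^+ 2].
Proof.
pose ga j := al j / be j.
have [nu [nu1 nuP]] := perp_direction (ga true - ga false).
have nunu : nu * conj nu = 1 by rewrite -normCK nu1 expr1n.
pose c := ga true * conj nu + conj (ga true) * nu.
have cE j : ga j * conj nu + conj (ga j) * nu = c.
  case: j => //; apply/eqP; rewrite eq_sym -subr_eq0 -nuP; apply/eqP.
  rewrite /c rmorphB /=; ring.
have cR : c \is Num.real.
  apply/CrealP; rewrite /c rmorphD !rmorphM /= !conjCK addrC.
  by rewrite [conj _ * _]mulrC [ga _ * _]mulrC.
have [t [p [tRq p0 p1 pt pt2]]] := unit_quadratic_roots cR.
have tR k : t k \is Num.real by have [] := tRq k.
have tq k : t k ^+ 2 + c * t k = 1 by have [] := tRq k.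
have tJ k : conj (t k) = t k by exact: conj_Creal.
exists p, (fun k => t k * nu).
split=> //.
- by rewrite !mulrA -mulrDl pt mul0r.
- by rewrite !normrM nu1 !mulr1 !real_normK.
move=> j k; rewrite !normCK.
have [b0|b0] := eqVneq (be j) 0.
  by rewrite b0 !mul0r !addr0.
have alE : al j = ga j * be j by rewrite divfK.
move: (ga j) alE (cE j) => g -> cg; rewrite rmorphD !rmorphM /= tJ.
(* Once |be j|^2 is factored out, the cross term is [c * t k], and the quadratic equation replaces
   t^2 + c t by 1. *)
have -> : (g * be j + be j * (t k * nu)) *
   (conj g * conj (be j) + conj (be j) * (t k * conj nu)) =
   be j * conj (be j) * (g * conj g + t k ^+ 2 * (nu * conj nu) +
     (g * conj nu + conj g * nu) * t k) by ring.
rewrite nunu cg mulr1 -[_ * _ + _ + _]addrA tq; ring.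
Qed.
End TwoPoint.

Section UnimodularFrame.
Variable R : realType.
Local Notation C := R[i].
Local Notation conj := (@Num.conj C).

Lemma sum4 (V : zmodType) (F : bool -> bool -> V) :
  \sum_(k < 4) F (odd k) (1 < k)%N =
  F true true + F true false + (F false true + F false false).
Proof.
rewrite !big_ord_recl big_ord0 /= addr0.
by rewrite [RHS](AC (2*2) (4*(2*(3*1)))).
Qed.

(** The number [r] is the cosine of an angle, and the conjugate pair is r + i q and r - i q, with
    [q] the sine. *)
Lemma unimodular_re (r : C) : 0 <= r -> r <= 1 -> exists ph : bool -> C,
  (forall k, `|ph k| = 1) /\ ph true + ph false = 2 * r.
Proof.
move=> r0 r1; pose q := sqrtC (1 - r ^+ 2).
have q0 : 0 <= q by rewrite sqrtC_ge0 subr_ge0 expr_le1.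
have qE : q ^+ 2 = 1 - r ^+ 2 by rewrite sqrtCK.
have iJ : conj 'i%R = - 'i%R by exact: conjCi.
exists (fun k => if k then r + 'i%R * q else r - 'i%R * q); split; last by ring.
have rJ : conj r = r by rewrite conj_Creal ?ger0_real.
have qJ : conj q = q by rewrite conj_Creal ?ger0_real.
have ii : 'i%R * 'i%R = -1 :> C by rewrite -expr2 sqrCi.
have main : (r + 'i%R * q) * (r - 'i%R * q) = 1.
  have -> : (r + 'i%R * q) * (r - 'i%R * q) =
    r ^+ 2 - ('i%R * 'i%R) * q ^+ 2 by ring.
  by rewrite ii qE; ring.
case; apply/eqP; rewrite -(eqrXn2 (n:=2)) // normCK expr1n.
  by rewrite rmorphD rmorphM /= iJ rJ qJ mulNr main.
by rewrite rmorphB rmorphM /= iJ rJ qJ mulNr opprK mulrC main.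
Qed.

Lemma orthonormal3_expansion (e f g : 'cV[C]_3) :
  cvdot e e = 1 -> cvdot f f = 1 -> cvdot g g = 1 ->
  cvdot f e = 0 -> cvdot g e = 0 -> cvdot g f = 0 ->
  forall x, x = cvdot x e *: e + (cvdot x f *: f + cvdot x g *: g).
Proof.
move=> ee ff gg fe ge gf x; pose u (i : 'I_3) := nth 0 [:: e; f; g] i.
have uu i j : cvdot (u i) (u j) = (i == j)%:R.
  case: i => [[|[|[|//]]] ?]; case: j => [[|[|[|//]]] ?];
    rewrite /u /= -?val_eqE /=;
    rewrite ?ee ?ff ?gg ?fe ?ge ?gf //;
    by rewrite cvdotC ?fe ?ge ?gf conjC0.
by rewrite -[LHS](orthonormal_expansion uu) !big_ord_recl big_ord0 addr0.
Qed.

(** The moments 1, 0, 1 of the weights say that the sum of p k times the rank one matrix of (1, z k)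
    is the identity. *)
Lemma weighted_frame_sum (V : lmodType C) (p z : bool -> C) (a b : C)
    (f1 f2 : V) :
  (forall k, 0 <= p k) -> p true + p false = 1 ->
  p true * z true + p false * z false = 0 ->
  p true * `|z true| ^+ 2 + p false * `|z false| ^+ 2 = 1 ->
  p true *: ((a + z true * b) *: (f1 + conj (z true) *: f2)) +
    p false *: ((a + z false * b) *: (f1 + conj (z false) *: f2)) =
  a *: f1 + b *: f2.
Proof.
move=> p0 p1 pz pz2.
have pzJ : p true * conj (z true) + p false * conj (z false) = 0.
  have := congr1 conj pz; rewrite rmorphD !rmorphM rmorph0 /=.
  by rewrite !(conj_Creal (ger0_real (p0 _))).
rewrite !scalerDr !scalerA addrACA -!scalerDl; congr (_ *: _ + _ *: _).
  transitivity ((p true + p false) * a +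
    (p true * z true + p false * z false) * b); first by ring.
  by rewrite p1 pz mul1r mul0r addr0.
transitivity ((p true * conj (z true) + p false * conj (z false)) * a +
  (p true * `|z true| ^+ 2 + p false * `|z false| ^+ 2) * b).
  by rewrite !normCK; ring.
by rewrite pzJ pz2 mul1r mul0r add0r.
Qed.

Lemma scalerDl2 (V : lmodType C) (a b c d : C) (x y : V) :
  a *: x + b *: x + (c *: y + d *: y) = (a + b) *: x + (c + d) *: y.
Proof. by rewrite !scalerDl. Qed.

(* With [g k = f1 + conj (z k) f2] for the two points [z] of [two_point], the
   weighted vectors [g k] form a tight frame of the plane orthogonal to [e], and
   each [cvdot (w i) (g k)] is unimodular. *)
Lemma unimodular_frame (e : 'cV[C]_3) (w : 'I_3 -> 'cV[C]_3) :
  cvdot e e = 1 -> (forall i, cvdot (w i) (w i) = 1) ->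
  (forall i, cvdot (w i) e = 0) ->
  exists (p : bool -> C) (g : bool -> 'cV[C]_3),
    [/\ forall k, 0 <= p k, p true + p false = 1, forall k, cvdot (g k) e = 0,
      forall x, p true *: (cvdot x (g true) *: g true) +
        p false *: (cvdot x (g false) *: g false) = x - cvdot x e *: e
    & forall i k, `|cvdot (w i) (g k)| = 1].
Proof.
move=> ee ww we; pose f1 := w ord0.
have [f2 [f22 f2e f21]] := exists_unit_perp e f1 (leqnn 3).
have f11 : cvdot f1 f1 = 1 by exact: ww.
have f1e : cvdot f1 e = 0 by exact: we.
have f12 : cvdot f1 f2 = 0 by rewrite cvdotC f21 conjC0.
have uE := orthonormal3_expansion ee f11 f22 f1e f2e f21.
have wE i : w i = cvdot (w i) f1 *: f1 + cvdot (w i) f2 *: f2.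
  by rewrite {1}(uE (w i)) we scale0r add0r.
(* Since [w ord0] is [f1], its coefficient against every [g k] is 1. The two equations of
   [two_point] are thus spent on the other two vectors. *)
pose j1 : 'I_3 := lift ord0 ord0; pose j2 : 'I_3 := ord_max.
pose al (j : bool) := cvdot (w (if j then j1 else j2)) f1.
pose be (j : bool) := cvdot (w (if j then j1 else j2)) f2.
have [p [z [p0 p1 pz pz2 zP]]] := two_point al be.
pose g k := f1 + conj (z k) *: f2.
have gE x k : cvdot x (g k) = cvdot x f1 + z k * cvdot x f2.
  by rewrite /g cvdotDr cvdotZr conjCK.
exists p, g; split=> //.
- by move=> k; rewrite /g cvdotDl cvdotZl f1e f2e mulr0 addr0.
- move=> x; rewrite {3}(uE x) addrAC subrr add0r !gE.
  exact: weighted_frame_sum.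
- move=> i k; apply/eqP; rewrite -(eqrXn2 (n:=2)) // expr1n gE; apply/eqP.
  have wi1 : `|cvdot (w i) f1| ^+ 2 + `|cvdot (w i) f2| ^+ 2 = 1.
    by rewrite -(cvdot_comb _ _ f11 f22 f12) -wE ww.
  have [i0|[ij|ij]] : i = ord0 \/ i = j1 \/ i = j2.
    case: i {wi1} => [[|[|[|//]]] ?]; [left|right; left|right; right];
      exact: val_inj.
  + by rewrite i0 f11 f12 mulr0 addr0 normr1 expr1n.
  + by rewrite -wi1 ij mulrC; exact: (zP true).
  + by rewrite -wi1 ij mulrC; exact: (zP false).
Qed.

(* The index [k < 4] encodes the pair of [odd k], a vector of the frame, and
   [1 < k], one of the two unimodular numbers of mean [r i]. *)
Lemma dilation_frame (e : 'cV[C]_3) (w : 'I_3 -> 'cV[C]_3) (r : 'I_3 -> C) :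
  cvdot e e = 1 -> (forall i, cvdot (w i) (w i) = 1) ->
  (forall i, cvdot (w i) e = 0) -> (forall i, 0 <= r i <= 1) ->
  exists (xi : nat -> C) (G : nat -> 'cV[C]_3) (d : 'I_3 -> nat -> C),
    [/\ forall k, 0 <= xi k /\ cvdot (G k) e = 0,
      \sum_(k < 4) xi k ^+ 2 = 1,
      forall i k, `|d i k| = 1,
      forall x, \sum_(k < 4) cvdot x (G k) *: G k = x - cvdot x e *: e
    & forall i, \sum_(k < 4) (d i k * xi k) *: G k = r i *: w i].
Proof.
move=> ee ww we r01.
have [p [g [p0 p1 ge gE gw]]] := unimodular_frame ee ww we.
have phP i : exists ph : bool -> C,
    (forall k, `|ph k| = 1) /\ ph true + ph false = 2 * r i.
  by have /andP[] := r01 i; exact: unimodular_re.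
have [ph phE] := boolp.choice phP.
have [ph1 phD] := all_and2 phE.
(* The weight p k is halved because each frame vector occurs twice, once for each phase. *)
have [q q0 qq] : exists2 q : bool -> C, forall k, 0 <= q k &
    forall k, q k * q k = p k / 2.
  exists (fun k => sqrtC (p k / 2)) => k; first by rewrite sqrtC_ge0 divr_ge0.
  by rewrite -expr2 sqrtCK.
have qJ k : conj (q k) = q k by rewrite conj_Creal ?ger0_real.
exists (fun k => q (odd k)), (fun k => q (odd k) *: g (odd k)).
exists (fun i k => cvdot (w i) (g (odd k)) * ph i (1 < k)%N); split.
- by move=> k; rewrite cvdotZl ge mulr0.
- by rewrite (sum4 (fun k _ => q k ^+ 2)) !expr2 !qq -[RHS]p1; field.
- by move=> i k; rewrite normrM gw ph1 mulr1.
- move=> x; rewrite -gE.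
  rewrite (sum4 (fun k _ => cvdot x (q k *: g k) *: (q k *: g k))).
  have hE k : cvdot x (q k *: g k) *: (q k *: g k) =
      (p k / 2) *: (cvdot x (g k) *: g k).
    by rewrite cvdotZr qJ !scalerA -qq; congr (_ *: _); ring.
  by rewrite (hE true) (hE false) scalerDl2 -!splitr.
- move=> i.
  rewrite (sum4 (fun k l =>
    (cvdot (w i) (g k) * ph i l * q k) *: (q k *: g k))).
  have hE k l : (cvdot (w i) (g k) * ph i l * q k) *: (q k *: g k) =
      (ph i l / 2) *: (p k *: (cvdot (w i) (g k) *: g k)).
    rewrite !scalerA; congr (_ *: _).
    have -> : cvdot (w i) (g k) * ph i l * q k * q k =
      cvdot (w i) (g k) * ph i l * (q k * q k) by ring.
    by rewrite qq; field.
  (* Summing over the phases leaves the factor [r i], and the sum over the frame then reproduces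
     [w i]. *)
  have meanE : ph i true / 2 + ph i false / 2 = r i.
    by rewrite -mulrDl phD; field.
  rewrite (hE true true) (hE true false) (hE false true) (hE false false).
  by rewrite scalerDl2 meanE -scalerDr gE we scale0r subr0.
Qed.
End UnimodularFrame.

(** * The common kernel and common range cases, and the theorem *)

Section Assembly.
Variable R : realType.
Local Notation C := R[i].
Local Notation conj := (@Num.conj C).

Definition coextendable (A : 'I_3 -> 'M[C]_3) :=
  exists (K : hilbertType R) (V : {linear 'cV[R[i]]_3 -> K})
         (S : 'I_3 -> {linear K -> K}),
    [/\ isometric_embedding V,
        forall i j : 'I_3, commuting_op (S i) (S j),
        forall i : 'I_3, isometry_op (S i)
      & forall i : 'I_3, coextension V (A i) (S i)].

Section Cases.
Variables (A : 'I_3 -> 'M[C]_3) (lambda r : 'I_3 -> C).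
Variables (e : 'cV[C]_3) (w : 'I_3 -> 'cV[C]_3).
Hypotheses (ee : cvdot e e = 1) (ww : forall i, cvdot (w i) (w i) = 1).
Hypotheses (we : forall i, cvdot (w i) e = 0) (r01 : forall i, 0 <= r i <= 1).
Hypothesis lambda1 : forall i, `|lambda i| <= 1.

(* Here C^p is the line spanned by [e], and [Q e = xi]. *)
Lemma coextendable_common_kernel :
  (forall i, A i = (lambda i)%:M +
    (1 - `|lambda i| ^+ 2) *: (r i *: outer (w i) e)) ->
  coextendable A.
Proof.
move=> AE.
have [xi [G [d [xiG xi1 d1 GE dE]]]] := dilation_frame ee ww we r01.
(* The unit vector [e] followed by a tight frame of its orthogonal plane is a Parseval frame of
   C^3. *)
pose b k := if k is k'.+1 then G k' else e.
pose N i := r i *: outer (w i) e.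
rewrite /coextendable.
apply: (@coextension_of_frame R 3 1 4 b (fun k _ => xi k)
  _ _ _ A N lambda d) => //.
- move=> x; rewrite big_split_ord big_ord1 /=.
  by rewrite [X in _ + X]GE addrC subrK.
- move=> x; rewrite big_ord1; under eq_bigr do rewrite big_ord1 normrM exprMn.
  rewrite -mulr_suml -[RHS]mul1r -[in RHS]xi1; congr (_ * _).
  by apply: eq_bigr => k _; rewrite ger0_norm //; have [] := xiG k.
- by move=> i; rewrite /N -scalemxAl -scalemxAr outer_sqr0 ?we // !scaler0.
- move=> i k _; rewrite /N -scalemxAl outerE /=.
  by have [_ ->] := xiG k; rewrite scale0r scaler0.
- move=> i [|j] // _; rewrite /N -scalemxAl outerE /= ee scale1r -dE.
  by apply: eq_bigr.
Qed.

(* Here C^p is the plane orthogonal to [e], embedded in C^m by the frame [G],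
   and [e] is placed at [xi] in the first copy of C^m. *)
Lemma coextendable_common_range :
  (forall i, A i = (lambda i)%:M +
    (1 - `|lambda i| ^+ 2) *: (r i *: outer e (w i))) ->
  coextendable A.
Proof.
move=> AE.
have [xi [G [d [xiG xi1 d1 GE dE]]]] := dilation_frame ee ww we r01.
have [f2 [f22 f2e f21]] := exists_unit_perp e (w ord0) (leqnn 3).
have f12 : cvdot (w ord0) f2 = 0 by rewrite cvdotC f21 conjC0.
have xiJ k : conj (xi k) = xi k.
  by rewrite conj_Creal ?ger0_real //; have [] := xiG k.
pose f (j : nat) := if j is 0 then w ord0 else f2.
have fe j : cvdot (f j) e = 0 by case: j => //=.
have fE x : cvdot x (f 0) *: f 0 + cvdot x (f 1) *: f 1 = x - cvdot x e *: e.
  rewrite {3}(orthonormal3_expansion ee (ww ord0) f22 (we ord0) f2e f21 x).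
  by rewrite addrAC subrr add0r.
(* As the squares of the first four [xi k] sum to 1, the four multiples of [e] reproduce the
   component along [e], and the orthonormal pair [f 0], [f 1] the rest. *)
pose b k := if (k < 2)%N then f k else xi (k - 2)%N *: e.
pose N i := r i *: outer e (w i).
rewrite /coextendable.
(* The weights are conjugated because the expansion of [r i *: w i] enters through the second,
   conjugate-linear argument of [cvdot]. *)
apply: (@coextension_of_frame R 3 2 4 b (fun k j => cvdot (f j) (G k))
  _ _ _ A N lambda (fun i k => conj (d i k))) => //.
- move=> x; rewrite big_split_ord /=.
  rewrite [X in X + _](_ : _ = x - cvdot x e *: e); last first.
    by rewrite -fE !big_ord_recl big_ord0 addr0.
  rewrite [X in _ + X](_ : _ = cvdot x e *: e) ?subrK //.
  rewrite -[RHS]scale1r -xi1 scaler_suml; apply: eq_bigr => k _.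
  rewrite /b ltnNge leq_addr /= addKn cvdotZr xiJ !scalerA.
  by congr (_ *: _); ring.
(* In terms of the vector [y] of the plane with coordinates [x], the isometry of [Q] is the Parseval
   identity for the frame [G]. *)
- move=> x; pose y := x 0 *: f 0 + x 1 *: f 1.
  have ye : cvdot y e = 0 by rewrite cvdotDl !cvdotZl !fe !mulr0 addr0.
  transitivity (cvdot y y); last first.
    rewrite [LHS](cvdot_comb _ _ (ww ord0) f22 f12).
    by rewrite !big_ord_recl big_ord0 addr0.
  have -> : cvdot y y = cvdot (y - cvdot y e *: e) y.
    by rewrite ye scale0r subr0.
  rewrite -GE cvdot_suml; apply: eq_bigr => k _.
  rewrite cvdotZl [cvdot (G k) y]cvdotC -normCK; congr (`|_| ^+ 2).
  by rewrite !big_ord_recl big_ord0 addr0 cvdotDl !cvdotZl ![_ * x _]mulrC.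
- by move=> i k; rewrite norm_conjC.
- move=> i; rewrite /N -scalemxAl -scalemxAr outer_sqr0 ?scaler0 //.
  by rewrite cvdotC we conjC0.
- move=> i k _; rewrite /N /b ltnNge leq_addr /= -scalemxAr -scalemxAl outerE.
  by rewrite cvdotC we conjC0 scale0r !scaler0.
- move=> i j j2; rewrite /N -scalemxAl outerE {1}/b j2 scalerA.
  have rJ : conj (r i) = r i.
    by rewrite conj_Creal // ger0_real //; have /andP[] := r01 i.
  rewrite -[X in X * _]rJ -cvdotZr -dE cvdot_sumr scaler_suml.
  apply: eq_bigr => k _; rewrite /b ltnNge leq_addr /= addKn cvdotZr.
  by rewrite rmorphM /= xiJ scalerA; congr (_ *: _); ring.
Qed.
End Cases.
End Assembly.

Theorem theorem4p3 (R : realType) (A : 'I_3 -> 'M[R[i]]_3)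
    (A_comm : forall i j : 'I_3, A i *m A j = A j *m A i)
    (A_contr : forall i : 'I_3, contraction_mx (A i))
    (A_form : forall i : 'I_3, scalar_plus_nilpotent2 (A i)) :
  exists (K : hilbertType R) (V : {linear 'cV[R[i]]_3 -> K})
         (S : 'I_3 -> {linear K -> K}),
    [/\ isometric_embedding V,
        forall i j : 'I_3, commuting_op (S i) (S j),
        forall i : 'I_3, isometry_op (S i)
      & forall i : 'I_3, coextension V (A i) (S i)].
Proof.
pose lambda i := projT1 (cid (A_form i)).
pose N i := A i - (lambda i)%:M.
have NN i : N i *m N i = 0.
  have [M [AE MM]] := projT2 (cid (A_form i)).
  have -> : N i = M by apply/eqP; rewrite subr_eq addrC; apply/eqP; exact: AE.
  exact: MM.
have Ncomm i j : N i *m N j = N j *m N i.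
  exact: comm_mx_sub_scalar.
have AN i : A i = (lambda i)%:M + N i by rewrite addrC subrK.
have [e [w [s [ee ws NE]]]] := square_zero_family_outer NN Ncomm.
have ww i : cvdot (w i) (w i) = 1 by have [] := ws i.
have we i : cvdot (w i) e = 0 by have [] := ws i.
have s0 i : 0 <= s i by have [] := ws i.
have ew i : cvdot e (w i) = 0 by rewrite cvdotC we conjC0.
have ls i : `|lambda i| <= 1 /\ s i <= 1 - `|lambda i| ^+ 2.
  have := A_contr i; rewrite AN; case: NE => ->.
    exact: contraction_outer ee (ww i) (ew i) (s0 i).
  exact: contraction_outer (ww i) ee (we i) (s0 i).
have l1 i : `|lambda i| <= 1 by have [] := ls i.
(* If |lambda i| = 1 the divisor is zero and [r i] is 0 by convention; this is consistent, as
   contractivity then forces [s i = 0]. *)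
pose r i := s i / (1 - `|lambda i| ^+ 2).
have D0 i : 0 <= 1 - `|lambda i| ^+ 2 by have [_] := ls i; exact: le_trans.
have sE i : s i = (1 - `|lambda i| ^+ 2) * r i.
  have [D00|Dn0] := eqVneq (1 - `|lambda i| ^+ 2) 0; last first.
    by rewrite mulrC divfK.
  rewrite D00 mul0r; apply: le_anti; rewrite s0 andbT -D00.
  by have [] := ls i.
have r01 i : 0 <= r i <= 1.
  rewrite divr_ge0 //=; have [D00|Dn0] := eqVneq (1 - `|lambda i| ^+ 2) 0.
    by rewrite /r D00 invr0 mulr0 ler01.
  by rewrite ler_pdivrMr ?mul1r; [have [] := ls i | rewrite lt_def Dn0 D0].
case: NE => NE.
  apply: (coextendable_common_range ee ww we r01 l1) => i.
  by rewrite AN NE sE scalerA.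
apply: (coextendable_common_kernel ee ww we r01 l1) => i.
by rewrite AN NE sE scalerA.
Qed.
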